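(* Let $\psi:\mathbb{R}\to\mathbb{R}_+$ be a convex function of the form $\psi(u)=u^{\varkappa}\theta(u)$ for $u>0$, with $\varkappa\in[1,2)$, where $\theta$ is slowly varying at zero and admits, for $u\in(0,1)$, the Karamata representation $$\theta(u)=c(u)\exp\left(\int_u^1\frac{\varepsilon(v)}{v}\,\mathrm{d}v\right),$$ where $c(\cdot)$ is a positive bounded measurable function with a nonzero limit at zero and $\varepsilon(\cdot)$ is a bounded measurable function with zero limit at zero. Assume further that there exists $\alpha\in(0,1)$ such that, for all sufficiently small $v>0$, $$\varepsilon(v)<\frac{1}{|\log v|^{\alpha}}.$$ Let $g(\cdot)$ be a slowly varying function at infinity satisfying, for some $\xi_\circ>2-\varkappa>\xi^\circ>0$, $$(\log b)^{-\xi_\circ}\ll g(b)\ll(\log b)^{-\xi^\circ},\quad b\to\infty,$$ and $$\int^{\infty}\frac{g(b)^{1/(2-\varkappa)}}{b}\,\mathrm{d}b<\infty$$ (convergence at infinity). Then, for any $r>0$, almost surely $$\liminf_{T\to\infty}\frac{I_W^{\psi}(T,r)}{T\,\psi(T^{-1/2})\,g(T)}=\infty.$$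
   Context: $W(\cdot)$ is a standard Wiener process on $[0,\infty)$ with $W(0)=0$. $AC[0,T]$ is the space of absolutely continuous functions on $[0,T]$. $\mathbb{R}_+=[0,\infty)$. For convex $\psi:\mathbb{R}\to\mathbb{R}_+$ and $h\in AC[0,T]$, $|h|_T^{\psi}:=\int_0^T\psi(h'(t))\,\mathrm{d}t$. For $T,r>0$, $I_W^{\psi}(T,r):=\inf\{|h|_T^{\psi}: h\in AC[0,T],\ h(0)=r,\ h(t)\ge W(t)\ \text{for all } t\in[0,T]\}$ (a random variable; equivalently one may require $h(0)=0$ and $h\ge W-r$). The notation $f\ll g$ means $f=O(g)$ in the indicated limit. Slowly varying functions are positive and measurable. *)

(* Defs.v *)
From HB Require Import structures.
From mathcomp Require Import all_boot all_order all_algebra.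
From mathcomp Require Import all_classical all_reals all_analysis.

Set Implicit Arguments.
Unset Strict Implicit.
Unset Printing Implicit Defensive.

Import Order.TTheory GRing.Theory Num.Theory.
Import numFieldNormedType.Exports.

Local Open Scope classical_set_scope.
Local Open Scope ring_scope.

(* The [=O_] notation needs a canonical [filter_on] structure. *)
Canonical pinfty_filter_on (R : numFieldType) : filter_on R :=
  FilterType (pinfty_nbhs R) _.

(* The process is indexed by the whole of R, but only its values at t >= 0 are
   constrained or used. Taking A i = setT for some of the i shows that
   [wiener_indep] contains the product rule for every subfamily of the
   increments. The second parameter of [normal_prob] is the standard
   deviation. *)
Record wiener_process (d : measure_display) (Omega : measurableType d)
    (R : realType) (P : probability Omega R) (W : R -> {RV P >-> R}) : Prop := {
  wiener_0 : {ae P, forall w, W 0 w = 0} ;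
  wiener_continuous :
    {ae P, forall w, {within `[0, +oo[, continuous (fun t : R => W t w)}} ;
  wiener_normal : forall (s t : R) (A : set R), 0 <= s -> s < t ->
    measurable A ->
    P ((W t \- W s) @^-1` A) =
      normal_prob 0 (Num.sqrt (t - s)) A ;
  wiener_indep : forall (n : nat) (t : nat -> R) (A : nat -> set R),
    0 <= t 0%N -> (forall i, (i < n)%N -> t i <= t i.+1) ->
    (forall i, measurable (A i)) ->
    P (\bigcap_(i < n) ((W (t i.+1) \- W (t i)) @^-1` A i)) =
      (\prod_(i < n) P ((W (t i.+1) \- W (t i))%R @^-1` A i))%E }.

Definition abs_continuous_on (R : realType) (a b : R) (h : R -> R) : Prop :=
  forall e : R, 0 < e -> exists2 delta : R, 0 < delta &
    forall (n : nat) (x y : 'I_n -> R),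
      (forall i, a <= x i /\ x i <= y i /\ y i <= b) ->
      trivIset [set: 'I_n] (fun i => `]x i, y i[%classic : set R) ->
      \sum_(i < n) (y i - x i) < delta ->
      \sum_(i < n) `|h (y i) - h (x i)| < e.

(* [h^`()] has an arbitrary value where the derivative does not exist; for an
   absolutely continuous [h] these points of [0, T] form a null set. *)
Definition energy (R : realType) (psi : R -> R) (T : R) (h : R -> R) : \bar R :=
  (\int[lebesgue_measure]_(t in `[0%R, T]) (psi (h^`()%classic t))%:E)%E.

(* [w] is a trajectory; the infimum of the empty set is +oo. *)
Definition min_energy (R : realType) (psi : R -> R) (w : R -> R) (T r : R) :
    \bar R :=
  ereal_inf [set energy psi T h | h in
    [set h : R -> R | [/\ abs_continuous_on 0 T h, h 0 = r &
                          forall t : R, 0 <= t <= T -> w t <= h t]]].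

(* Positivity and measurability are required on a neighbourhood of the point at
   which the function varies slowly. *)
Definition slowly_varying_at_infinity (R : realType) (L : R -> R) : Prop :=
  [/\ exists X : R, measurable_fun `[X, +oo[%classic L /\
        (forall x : R, X <= x -> 0 < L x) &
      forall c : R, 0 < c -> L (c * x) / L x @[x --> +oo] --> (1 : R)].

Definition slowly_varying_at_zero (R : realType) (L : R -> R) : Prop :=
  [/\ exists2 X : R, 0 < X & measurable_fun `]0, X[%classic L /\
        (forall x : R, 0 < x < X -> 0 < L x) &
      forall c : R, 0 < c -> L (c * x) / L x @[x --> 0^'+] --> (1 : R)].

Record karamata_representation (R : realType) (theta c eps : R -> R) : Prop := {
  karamata_eq : forall u : R, 0 < u < 1 -> theta u =
    c u * expR (\int[lebesgue_measure]_(v in `]u, 1[%classic) (eps v / v)) ;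
  karamata_c_pos : forall u : R, 0 < u < 1 -> 0 < c u ;
  karamata_c_bounded : [bounded c u | u in (`]0, 1[%classic : set R)] ;
  karamata_c_meas : measurable_fun (`]0, 1[%classic : set R) c ;
  karamata_c_lim : exists2 c0 : R, c0 != 0 & c u @[u --> 0^'+] --> c0 ;
  karamata_eps_bounded : [bounded eps v | v in (`]0, 1[%classic : set R)] ;
  karamata_eps_meas : measurable_fun (`]0, 1[%classic : set R) eps ;
  karamata_eps_lim : eps v @[v --> 0^'+] --> (0 : R) }.

(* Main.v *)
(** Let T = 2^k, f = g(T)^(1/(2-kappa)) and h = T f^2, and sample W at the
    multiples of h. If W(ih) exceeds sqrt h (A+1) i^gamma for some i <= f^-2,
    then by Jensen's inequality every admissible path has energy at least
    ih psi(A i^(gamma-1) / sqrt h). When 1 - 1/kappa < gamma, the Karamata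
    representation and the bound on eps make this at least a prescribed multiple
    of T psi(T^(-1/2)) g(T) once A is large. When moreover gamma < 1/2, the
    random walk W(ih) stays below the barrier for n steps with probability
    O(n^(-1/2)), which for n of order f^-2 is O(f(T)); the integral condition
    makes this summable over T = 2^k, and Borel-Cantelli applies. Since a slowly
    varying g is comparable to a constant on [2^k, 2^(k+1)], the bound extends
    to all large T. *)

Require Import Defs.
From HB Require Import structures.
From mathcomp Require Import all_boot all_order all_algebra.
From mathcomp Require Import all_classical all_reals all_analysis.
From mathcomp Require Import measurable_realfun.
From mathcomp Require Import ring lra.

Set Implicit Arguments.
Unset Strict Implicit.
Unset Printing Implicit Defensive.

Import Order.TTheory GRing.Theory Num.Theory.
Import numFieldNormedType.Exports.

Local Open Scope classical_set_scope.
Local Open Scope ring_scope.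

(** The range for gamma is nonempty precisely because kappa < 2. The exponent 1/(2-kappa) solves
    f^(2-kappa) = g(T), which balances h psi(1/sqrt h) against T psi(T^(-1/2)) g(T) up to the slowly
    varying factor. That factor is the obstacle: theta is compared at two points whose ratio can be
    of order 1/f and so tends to infinity. The lower bound on g keeps ln(1/f) of order ln ln T, and
    over such a range the bound on eps lets theta vary only by a constant. The estimate O(n^(-1/2))
    has to be uniform in the step h, which changes with T. It comes from an expectation argument:
    the mean distance of the surviving walk below the barrier stays bounded, because the barrier
    increments weighted by i^(-1/2) are summable when gamma < 1/2, whereas survival by itself would
    force this distance to be of order sqrt n. Jensen's inequality needs the fundamental theorem of
    calculus for absolutely continuous paths, with the pointwise derivative that occurs in [energy].
    It is obtained from the Jordan decomposition, Radon-Nikodym densities and Lebesgue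
    differentiation. *)

Definition mfun_of d1 d2 (T1 : measurableType d1) (T2 : measurableType d2)
    (f : T1 -> T2) (mf : measurable_fun setT f) : {mfun T1 >-> T2} :=
  HB.pack f (isMeasurableFun.Build _ _ _ _ f mf).

(** The integral of a nonnegative function is a supremum over the simple functions below it, so
    monotonicity needs no measurability. This matters for [energy], whose integrand is not known to
    be measurable. *)
Lemma le_integral_of_ge0 d (T : measurableType d) (R : realType)
    (nu : {measure set T -> \bar R})
    (D : set T) (k f : T -> \bar R) :
  (forall x, D x -> 0 <= k x)%E -> (forall x, D x -> k x <= f x)%E ->
  (\int[nu]_(x in D) k x <= \int[nu]_(x in D) f x)%E.
Proof.
move=> k0 kf; rewrite !ge0_integralE//; last first.
  by move=> x Dx; rewrite (le_trans (k0 _ Dx))// kf.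
apply: le_ereal_sup => _ [h hk <-]; exists h => // x.
apply: le_trans (hk x) _; rewrite /patch; case: ifPn => // /set_mem; exact: kf.
Qed.

(** * Energy of absolutely continuous paths *)

Section AbsolutelyContinuous.
Variable R : realType.
Implicit Types (a b s e : R) (h F : R -> R) (L : seq (R * R)).
Local Notation mu := (@lebesgue_measure R).

(* A subinterval [x, y] is encoded as the pair (y, x), as in [variation_zip]. *)
Definition nonoverlapping a b L :=
  all (fun p => [&& a <= p.2, p.2 <= p.1 & p.1 <= b]) L &&
  pairwise (fun p q => (p.1 <= q.2) || (q.1 <= p.2)) L.

Lemma abs_continuous_on_seq a b h e : abs_continuous_on a b h -> 0 < e ->
  exists2 delta, 0 < delta & forall L, nonoverlapping a b L ->
    \sum_(p <- L) (p.1 - p.2) < delta ->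
    \sum_(p <- L) `|h p.1 - h p.2| < e.
Proof.
move=> ach e0; have [delta d0 H] := ach e e0; exists delta => // L.
move=> /andP[/allP Lab /(pairwiseP (0, 0)) Lp] Ld.
have := H (size L) (fun i => (nth (0, 0) L i).2) (fun i => (nth (0, 0) L i).1).
rewrite !(big_nth (0, 0)) !big_mkord in Ld *; apply => //.
  move=> i; have /Lab/and3P[] := mem_nth (0, 0) (ltn_ord i).
  by [].
apply/trivIsetP => i j _ _ ij; rewrite -subset0 => x /= [].
rewrite !in_itv/= => /andP[ix xi] /andP[jx xj].
have wl (k l : 'I_(size L)) : (k < l)%N -> x < (nth (0, 0) L k).1 ->
    (nth (0, 0) L k).2 < x -> x < (nth (0, 0) L l).1 ->
    (nth (0, 0) L l).2 < x -> False.
  move=> ij' ? ? ? ?.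
  have := Lp k l (ltn_ord k) (ltn_ord l) ij'.
  by case/orP => ?; lra.
have [ij'|ij'|ij'] := ltngtP i j.
- exact: (wl i j).
- exact: (wl j i).
- by move/eqP: ij; apply; exact: val_inj.
Qed.

Lemma itv_partition_nonoverlapping (x y : R) (s : seq R) : itv_partition x y s ->
  nonoverlapping x y (zip s (x :: s)) /\
  \sum_(p <- zip s (x :: s)) (p.1 - p.2) = y - x.
Proof.
elim: s x => [x [_ /eqP/= <-]|z s ih x]; first by rewrite big_nil subrr.
move=> /[dup] /itv_partition_cons /[dup] zys /ih[/andP[a1 p1] sE].
move=> [/= /andP[xz _] _].
have zy := itv_partition_le zys.
rewrite big_cons sE; split; last by rewrite addrC -addrA addKr.
rewrite /nonoverlapping /= lexx (ltW xz) zy p1 !andbT/=.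
apply/andP; split.
  apply: sub_all a1 => p /and3P[zp -> ->]; rewrite !andbT.
  by rewrite (le_trans (ltW xz)).
by apply: sub_all a1 => p /and3P[-> ].
Qed.

Lemma nonoverlapping_refine a b x y L L1 L2 :
  nonoverlapping a b (L2 ++ (y, x) :: L1) ->
  nonoverlapping x y L -> nonoverlapping a b ((L2 ++ L) ++ L1).
Proof.
rewrite /nonoverlapping -catA !all_cat !pairwise_cat allrel_consr allrel_catr/=.
move=> /andP[/and3P[-> /and3P[ax xy yb] ->]] /and3P[/andP[L2xy ->] -> /andP[xyL1 ->]].
move=> /andP[aL ->]; rewrite /= !andbT; apply/and3P; split.
- apply: sub_all aL => p /and3P[xp -> py]; rewrite (le_trans ax xp)/=.
  exact: le_trans yb.
- apply/allrelP => q p /(allP L2xy)/= + /(allP aL)/and3P[xp pp py].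
  move=> /orP[qx|yq]; first by rewrite (le_trans qx xp).
  by rewrite (le_trans py yq) orbT.
- apply/allrelP => p q /(allP aL)/and3P[xp pp py] /(allP xyL1)/= /orP[yq|qx].
    by rewrite (le_trans py yq).
  by rewrite (le_trans qx xp) orbT.
Qed.

(** Each interval may be replaced by any partition of it without changing the total length, so the
    bound on increments survives the supremum over partitions; only strictness is lost. *)
Lemma abs_continuous_on_total_variation a b h e : abs_continuous_on a b h ->
  0 < e ->
  exists2 delta, 0 < delta & forall L, nonoverlapping a b L ->
    \sum_(p <- L) (p.1 - p.2) < delta ->
    (\sum_(p <- L) total_variation p.2 p.1 h <= e%:E)%E.
Proof.
move=> ach e0; have [delta d0 H] := abs_continuous_on_seq ach e0.
exists delta => //.
(* The suprema are taken one interval at a time: [L1] holds the intervals still measured by their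
   variation, [L2] those already replaced by a partition. *)
suff main L1 L2 : nonoverlapping a b (L2 ++ L1) ->
    \sum_(p <- L2 ++ L1) (p.1 - p.2) < delta ->
    (\sum_(p <- L1) total_variation p.2 p.1 h +
     (\sum_(p <- L2) `|h p.1 - h p.2|)%:E <= e%:E)%E.
  move=> L aL Ld; have := main L [::]; rewrite big_nil adde0.
  exact.
elim: L1 L2 => [L2|[y x] L1 ih L2 aL Ld].
  by rewrite cats0 => aL Ld; rewrite big_nil add0e lee_fin ltW// H.
have xyn : nonoverlapping x y [::] by [].
have := nonoverlapping_refine aL xyn; rewrite cats0 => aL12.
have xy : x <= y.
  move: aL => /andP[/allP/(_ (y, x))]; rewrite mem_cat !inE eqxx/= orbT.
  by move=> /(_ erefl)/and3P[].
have Ld12 : \sum_(p <- L2 ++ L1) (p.1 - p.2) < delta.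
  apply: le_lt_trans Ld; rewrite !big_cat/= big_cons/= lerD2l lerDr subr_ge0.
  by [].
have c0 : (0 <= \sum_(p <- L1) total_variation p.2 p.1 h +
     (\sum_(p <- L2) `|h p.1 - h p.2|)%:E)%E.
  rewrite adde_ge0// ?lee_fin ?sumr_ge0// big_seq sume_ge0// => p pL1.
  apply: total_variation_ge0.
  move: aL12 => /andP[/allP/(_ p)]; rewrite mem_cat pL1 orbT => /(_ erefl)/and3P[].
  by [].
have cfin : (\sum_(p <- L1) total_variation p.2 p.1 h +
     (\sum_(p <- L2) `|h p.1 - h p.2|)%:E)%E \is a fin_num.
  by rewrite ge0_fin_numE// (le_lt_trans (ih _ aL12 Ld12)) ?ltry.
rewrite big_cons -addeA -leeBrDr//.
apply: ge_ereal_sup => _ [_ [s /[dup] xys /itv_partition_nonoverlapping[nxy sE] <-] <-].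
rewrite leeBrDr// addeCA (variation_zip _ xys) -EFinD [X in X%:E]addrC -big_cat.
apply: ih; first exact: nonoverlapping_refine aL nxy.
move: Ld; rewrite !big_cat big_cons sE /=.
lra.
Qed.

(** The projection onto [0, s]. Composing with it extends a path from [0, s] to the whole line by
    constants, as Stieltjes measures require, and it is 1-Lipschitz, hence preserves absolute
    continuity. *)
Definition clamp s (x : R) := Num.max 0 (Num.min x s).

Lemma clampP s x : 0 <= s ->
  [\/ x <= 0 /\ clamp s x = 0, 0 <= x <= s /\ clamp s x = x |
      s <= x /\ clamp s x = s].
Proof.
move=> s0; rewrite /clamp; case: (leP x s) => [xs|/ltW sx].
  by case: (leP 0 x) => x0; [apply: Or32|apply: Or31; split => //; exact: ltW].
by apply: Or33; rewrite max_r.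
Qed.

Lemma clamp_id s x : 0 <= x <= s -> clamp s x = x.
Proof. by move=> /andP[x0 xs]; rewrite /clamp min_l// max_r. Qed.

Lemma clamp_ge0 s x : 0 <= clamp s x.
Proof. by rewrite /clamp le_max lexx. Qed.

Lemma clamp_le s x : 0 <= s -> clamp s x <= s.
Proof. by move=> s0; rewrite /clamp ge_max s0 ge_min lexx orbT. Qed.

Lemma le_clamp s x y : x <= y -> clamp s x <= clamp s y.
Proof.
move=> xy; rewrite /clamp ge_max !le_max lexx/= le_min !ge_min lexx xy orbT.
by rewrite orbT.
Qed.

Lemma clamp_lipschitz s x y : 0 <= s -> x <= y ->
  clamp s y - clamp s x <= y - x.
Proof.
move=> s0 xy.
by have [[? ->]|[/andP[? ?] ->]|[? ->]] := clampP x s0;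
  have [[? ->]|[/andP[? ?] ->]|[? ->]] := clampP y s0; lra.
Qed.

Lemma abs_continuous_on_clamp a b s h : 0 <= s -> abs_continuous_on 0 s h ->
  abs_continuous_on a b (h \o clamp s).
Proof.
move=> s0 ach e e0; have [delta d0 H] := ach e e0; exists delta => //.
move=> n x y xy xyd xys.
apply: (H n (clamp s \o x) (clamp s \o y)).
- move=> i; have [_ [xyi _]] := xy i; rewrite clamp_ge0 clamp_le// le_clamp//.
- apply/trivIsetP => i j _ _ ij.
  move/trivIsetP : xyd => /(_ i j Logic.I Logic.I ij).
  apply: subsetI_eq0 => z /=; rewrite !in_itv/=.
    by have [[? ->]|[/andP[? ?] ->]|[? ->]] := clampP (x i) s0;
      have [[? ->]|[/andP[? ?] ->]|[? ->]] := clampP (y i) s0; lra.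
  by have [[? ->]|[/andP[? ?] ->]|[? ->]] := clampP (x j) s0;
    have [[? ->]|[/andP[? ?] ->]|[? ->]] := clampP (y j) s0; lra.
- apply: le_lt_trans xys; apply: ler_sum => i _; apply: clamp_lipschitz => //.
  by have [_ []] := xy i.
Qed.

Lemma lebesgue_stieltjes_ocE (F : cumulative R R) a b : a <= b ->
  lebesgue_stieltjes_measure F `]a, b] = (F b - F a)%:E.
Proof.
move=> ab; rewrite /lebesgue_stieltjes_measure /measure_extension/=.
by rewrite measurable_mu_extE/= ?wlength_itv_bnd//; exact: is_ocitv.
Qed.

Lemma open_bounded_disjoint_itv (V : set R) s : 0 < s -> open V -> V `<=` `]0, s[ ->
  exists x y : nat -> R, [/\ forall n, [/\ 0 <= x n, x n <= y n & y n <= s],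
    trivIset setT (fun n => `]x n, y n[%classic) &
    V = \bigcup_n `]x n, y n[%classic].
Proof.
move=> s0 oV V0s; pose I := open_disjoint_itv oV.
have IV n : I n `<=` `]0, s[.
  by apply: subset_trans V0s; rewrite [X in _ `<=` X](open_disjoint_itv_bigcup oV); exact: bigcup_sup.
have IE : (fun n => `]inf (I n), sup (I n)[%classic) = I.
  apply/funext => n.
  have /interior_id In := @open_disjoint_itv_open _ _ oV n.
  rewrite -[RHS]In interval_bounded_interior.
  - by apply/seteqP; split => x /=; rewrite in_itv.
  - exact: open_disjoint_itv_is_interval.
  - by exists 0 => x /IV /=; rewrite in_itv/= => /andP[/ltW].
  - by exists s => x /IV /=; rewrite in_itv/= => /andP[_ /ltW].
exists (inf \o I), (sup \o I); split => [n|/=|/=].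
(* An empty component becomes the degenerate interval at 0, since [inf] and [sup] of the empty set
   are 0. *)
- have [In0|/set0P[r Ir]] := eqVneq (I n) set0; first by rewrite /= In0 inf0 sup0 lexx ltW.
  have I0 : I n !=set0 by exists r.
  have : r \in `]inf (I n), sup (I n)[ by move: Ir; rewrite -{1}IE inE.
  rewrite in_itv/= => /andP[ir rs]; split.
  + by apply: lb_le_inf => // x /IV /=; rewrite in_itv/= => /andP[/ltW].
  + by rewrite ltW// (lt_trans ir).
  + by apply: ge_sup => // x /IV /=; rewrite in_itv/= => /andP[_ /ltW].
- by rewrite IE; exact: open_disjoint_itv_trivIset.
- by rewrite IE; exact: open_disjoint_itv_bigcup.
Qed.

(** An interval shorter than [delta] carries variation at most 1; steps of length [delta / 2] reach
    [s] after finitely many of them. *)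
Lemma abs_continuous_on_bounded_variation s h : 0 <= s ->
  abs_continuous_on 0 s h -> bounded_variation 0 s h.
Proof.
move=> s0 ach; have [delta d0 H] := abs_continuous_on_total_variation ach ltr01.
have step x y : 0 <= x -> x <= y -> y <= s -> y - x < delta ->
    (total_variation x y h <= 1%:E)%E.
  move=> x0 xy ys xyd; have := H [:: (y, x)]; rewrite !big_seq1/=; apply => //.
  by rewrite /nonoverlapping/= x0 xy ys.
have d20 : 0 < delta / 2 by rewrite divr_gt0.
suff main n x : 0 <= x <= s -> x <= n%:R * (delta / 2) ->
    (total_variation 0 x h < +oo)%E.
  apply/bounded_variationP => //; rewrite ge0_fin_numE; last exact: total_variation_ge0.
  apply: (main (Num.bound (s / (delta / 2)))); rewrite ?s0 ?lexx//.
  rewrite -ler_pdivrMr// ltW// (le_lt_trans (ler_norm _))//.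
  by have := archi_boundP (normr_ge0 (s / (delta / 2))); rewrite /Num.Def.archi_bound normr_id.
elim: n x => [x /andP[x0 _]|n ih x /andP[x0 xs] xn].
  rewrite mul0r => xle0; rewrite (@le_anti _ _ x 0) ?x0 ?xle0//.
  by rewrite total_variationxx.
have [xn'|nx] := leP x (n%:R * (delta / 2)); first by apply: ih; rewrite ?x0.
have n0 : 0 <= n%:R * (delta / 2) by rewrite mulr_ge0// ltW.
rewrite (total_variationD _ n0 (ltW nx)) lte_add_pinfty//.
  by apply: ih; rewrite ?n0 ?lexx// (le_trans (ltW nx)).
rewrite (le_lt_trans (step _ _ n0 (ltW nx) xs _)) ?ltry//.
by move: xn; rewrite -natr1 mulrDl mul1r; lra.
Qed.

Lemma abs_continuous_on_tv s h : 0 <= s -> abs_continuous_on 0 s h ->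
  abs_continuous_on 0 s (fun x => fine (total_variation 0 x h)).
Proof.
move=> s0 ach e e0; have e20 : 0 < e / 2 by rewrite divr_gt0.
have bvh := abs_continuous_on_bounded_variation s0 ach.
have [delta d0 H] := abs_continuous_on_total_variation ach e20; exists delta => //.
move=> n x y xy xyd xys; apply: (@le_lt_trans _ _ (e / 2)); last by lra.
have tvE i : `|fine (total_variation 0 (y i) h) - fine (total_variation 0 (x i) h)| =
    fine (total_variation (x i) (y i) h).
  have [x0 [xyi ys]] := xy i.
  have fin u v : 0 <= u -> u <= v -> v <= s -> total_variation u v h \is a fin_num.
    move=> u0 uv vs; apply/bounded_variationP => //.
    apply: (bounded_variationl uv vs); apply: (bounded_variationr u0) => //.
    exact: le_trans vs.
  rewrite (total_variationD _ x0 xyi) fineD ?fin// ?(le_trans xyi)//.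
  by rewrite addrC addKr ger0_norm// fine_ge0// total_variation_ge0.
(* Degenerate intervals are dropped: being empty they are disjoint from all others, yet their
   endpoint may lie inside another interval, which [nonoverlapping] forbids. *)
pose L := [seq (y i, x i) | i <- [seq i <- enum 'I_n | x i < y i]].
have sumL (G : R -> R -> \bar R) : (forall u, G u u = 0%E) ->
    (\sum_(p <- L) G p.1 p.2 = \sum_(i < n) G (y i) (x i))%E.
  move=> G0; rewrite big_map big_filter big_enum_cond/= big_mkcond/=.
  apply: eq_bigr => i _; case: ifPn => //; rewrite -leNgt => yx.
  have [_ [xyi _]] := xy i.
  by rewrite (@le_anti _ _ (x i) (y i)) ?G0// xyi.
rewrite -lee_fin (le_trans _ (H L _ _))//.
- rewrite (sumL (fun u v => total_variation v u h)) => [|u]; last exact: total_variationxx.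
  rewrite -sumEFin; apply: lee_sum => i _; rewrite tvE.
  rewrite fineK//; apply/bounded_variationP; have [x0 [xyi ys]] := xy i => //.
  apply: (bounded_variationl xyi ys); apply: (bounded_variationr x0) => //.
  exact: le_trans ys.
- apply/andP; split.
    by apply/allP => _ /mapP[i _ ->]/=; have [-> [-> ->]] := xy i.
  rewrite pairwise_map.
  have := filter_uniq (fun i => x i < y i) (enum_uniq 'I_n); rewrite uniq_pairwise.
  apply: (@sub_in_pairwise _ [pred i | x i < y i]); last exact: filter_all.
  move=> i j; rewrite !inE/= => xyi xyj /= ij.
  rewrite leNgt -implybE; apply/implyP => xjyi; rewrite leNgt; apply/negP => xiyj.
  move/trivIsetP : xyd => /(_ i j Logic.I Logic.I ij).
  (* The midpoint of the overlap, a common point of two intervals supposed disjoint. *)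
  pose z := (Num.max (x i) (x j) + Num.min (y i) (y j)) / 2.
  have : Num.max (x i) (x j) < Num.min (y i) (y j) by rewrite gt_max !lt_min xyi xyj xjyi xiyj.
  have : x i <= Num.max (x i) (x j) by rewrite le_max lexx.
  have : x j <= Num.max (x i) (x j) by rewrite le_max lexx orbT.
  have : Num.min (y i) (y j) <= y i by rewrite ge_min lexx.
  have : Num.min (y i) (y j) <= y j by rewrite ge_min lexx orbT.
  move=> ? ? ? ? ?; rewrite -subset0 => /(_ z); apply.
  by split; rewrite /= in_itv/= /z; apply/andP; split; lra.
- rewrite -lte_fin -sumEFin (sumL (fun u v => (u - v)%:E)) ?sumEFin// => u.
  by rewrite subrr.
Qed.

Lemma abs_continuousB s h1 h2 : abs_continuous_on 0 s h1 -> abs_continuous_on 0 s h2 ->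
  abs_continuous_on 0 s (fun x => h1 x - h2 x).
Proof.
move=> ac1 ac2 e e0; have e20 : 0 < e / 2 by rewrite divr_gt0.
have [d1 d10 H1] := ac1 _ e20; have [d2 d20 H2] := ac2 _ e20.
exists (Num.min d1 d2); first by rewrite lt_min d10.
move=> n x y xy xyd; rewrite lt_min => /andP[xy1 xy2].
have := H1 _ _ _ xy xyd xy1; have := H2 _ _ _ xy xyd xy2.
set S1 := \sum_(i < n) _; set S2 := \sum_(i < n) _ => S1e S2e.
apply: (@le_lt_trans _ _ (S2 + S1)); last by lra.
rewrite /S1 /S2 -big_split/=; apply: ler_sum => i _.
rewrite [leLHS](_ : _ = `|(h1 (y i) - h1 (x i)) - (h2 (y i) - h2 (x i))|).
  exact: ler_normB.
by congr (`| _ |); ring.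
Qed.

Lemma abs_continuous_on_continuous a b h x : abs_continuous_on a b h -> a < x < b ->
  {for x, continuous h}.
Proof.
move=> ach /andP[ax xb]; apply/cvgrPdist_lt => e e0.
have [delta d0 H] := ach _ e0.
have H1 u v : a <= u -> u <= v -> v <= b -> v - u < delta -> `|h v - h u| < e.
  move=> au uv vb uvd.
  have := H 1%N (fun=> u) (fun=> v); rewrite !big_ord1; apply => //.
  by apply/trivIsetP => i j _ _; rewrite !ord1 eqxx.
near=> y.
have ay : a <= y by near: y; exact: (cvgr_ge x).
have yb : y <= b by near: y; exact: (cvgr_le x).
have : `|x - y| < delta by near: y; exact: cvgr_dist_lt.
have [xy|/ltW yx] := leP x y.
  by rewrite ler0_norm ?subr_le0// opprB distrC => yxd; apply: H1 => //; exact: ltW.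
by rewrite ger0_norm ?subr_ge0// => yxd; apply: H1 => //; exact: ltW.
Unshelve. all: by end_near. Qed.

(** Outer regularity puts the null set inside an open set of length below [delta]; its components
    are disjoint intervals, so absolute continuity bounds the sum of their [F]-increments by [e]. *)
Lemma lebesgue_stieltjes_dominated (F : cumulative R R) s : 0 < s ->
  abs_continuous_on 0 s F -> forall N : set R, measurable N -> mu N = 0%E ->
  lebesgue_stieltjes_measure F (N `&` `]0, s[) = 0%E.
Proof.
move=> s0 acF N mN muN.
apply/eqP; rewrite eq_le measure_ge0 andbT; apply/lee_addgt0Pr => e e0.
rewrite add0e.
have [delta d0 H] := acF _ e0.
have muNoo : (mu N < +oo)%E by rewrite muN.
have [U [oU NU muU]] := lebesgue_regularity_outer mN muNoo d0.
have mU : measurable U by exact: measurable_realfun.open_measurable.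
have {}muU : (mu U < delta%:E)%E.
  have : (mu U <= mu N + mu (U `\` N))%E.
    by rewrite -{1}(setDUK NU); apply: measureU2 => //; exact: measurableD.
  by move=> /le_lt_trans; apply; rewrite muN add0e.
have oV : open (U `&` `]0, s[) by apply: openI => //; exact: interval_open.
have [x [y [xy txy VE]]] := open_bounded_disjoint_itv s0 oV (@subIsetr _ _ _).
apply: (@le_trans _ _ (lebesgue_stieltjes_measure F (U `&` `]0, s[))).
  apply: le_measure; rewrite ?inE; [exact: measurableI|exact: measurableI|].
  exact: setSI.
rewrite VE measure_bigcup//.
apply: lime_le; first exact: is_cvg_nneseries.
apply: nearW => n; apply: (@le_trans _ _ (\sum_(i < n) (F (y i) - F (x i))%:E)%E).
  rewrite big_mkord (eq_bigl xpredT); last by move=> i; rewrite in_setT.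
  apply: lee_sum => i _; have [_ xyi _] := xy i.
  rewrite -lebesgue_stieltjes_ocE// le_measure ?inE//.
  exact: subset_itv_oo_oc.
rewrite sumEFin lee_fin (le_trans _ (ltW (H n (x \o val) (y \o val) _ _ _)))//.
- by apply: ler_sum => i _; exact: ler_norm.
- by move=> i; have [] := xy i.
- apply/trivIsetP => i j _ _ ij.
  by move/trivIsetP : txy => /(_ i j Logic.I Logic.I); apply; apply: contra_neq ij => /val_inj.
- rewrite -lte_fin (le_lt_trans _ muU)// -sumEFin.
  rewrite [leLHS](_ : _ = mu (\big[setU/set0]_(i < n) `]x i, y i[%classic)); last first.
    rewrite (@measure_bigsetU _ _ _ mu (fun n => `]x n, y n[%classic))//.
    apply: eq_bigr => i _; rewrite [RHS]lebesgue_measure_itv/= lte_fin.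
    have [_ xyi _] := xy i; case: ltP => // yxi.
    by rewrite (@le_anti _ _ (x i) (y i)) ?subrr ?xyi.
  apply: le_measure; rewrite ?inE//; first exact: bigsetU_measurable.
  apply: (@subset_trans _ (U `&` `]0, s[)); last exact: subIsetl.
  by rewrite VE; exact: bigsetU_bigcup.
Qed.

(** The density is the Radon-Nikodym derivative of the Stieltjes measure of [F]; Lebesgue
    differentiation identifies it with the derivative of [F] almost everywhere. *)
Lemma nondecreasing_abs_continuous_density F s : 0 < s ->
  {homo F : x y / x <= y} -> (forall a b, abs_continuous_on a b F) ->
  exists f : R -> R, [/\ mu.-integrable setT (EFin \o f),
    {ae mu, forall x, 0 < x < s -> is_derive x (1:R) F (f x)} &
    forall x, 0 <= x <= s -> F x - F 0 = \int[mu]_(t in `]0, x]) f t].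
Proof.
move=> s0 ndF acF.
have cF : continuous F.
  move=> x; apply: (@abs_continuous_on_continuous (x - 1) (x + 1)) => //.
  by apply/andP; split; lra.
pose Fc : cumulative R R :=
  HB.pack F (isCumulative.Build R _ R F ndF (right_continuousW cF)).
pose nu : {measure set (measurableTypeR R) -> \bar R} := lebesgue_stieltjes_measure Fc.
(* Restricting to a bounded interval makes the measure finite. The margin 1 keeps the endpoint [s]
   inside the open interval. *)
pose D : set (measurableTypeR R) := `]0, (s + 1)[%classic.
have mD : measurable D by exact: measurable_itv.
have nu_oc x : 0 <= x -> nu `]0, x]%classic = (F x - F 0)%:E.
  by move=> x0; exact: lebesgue_stieltjes_ocE.
have nuD : (nu D < +oo)%E.
  apply: (@le_lt_trans _ _ (nu `]0, (s + 1)]%classic)).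
    by rewrite le_measure ?inE//; exact: subset_itv_oo_oc.
  by rewrite nu_oc ?ltry//; lra.
pose nuD' : {finite_measure set (measurableTypeR R) -> \bar R} := mfrestr mD nuD.
have dom : nuD' `<< mu.
  apply/null_content_dominatesP => N mN muN.
  rewrite /= /mfrestr /= /mrestr /=.
  by apply: lebesgue_stieltjes_dominated => //; lra.
have [f [f0 ffin fint nuE]] := radon_nikodym_sigma_finite dom.
exists (fine \o f).
have fE : EFin \o (fine \o f) = f by apply/funext => x /=; rewrite fineK.
have FE x : 0 <= x < s + 1 -> F x - F 0 = \int[mu]_(t in `]0, x]) (fine \o f) t.
  move=> /andP[x0 xs]; apply: EFin_inj.
  have mx : measurable (`]0, x]%classic : set R) by [].
  rewrite /Rintegral.
  under eq_integral do rewrite /= fineK//.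
  rewrite -nuE// fineK; last exact: fin_num_measure.
  rewrite -nu_oc//= /mfrestr/= /mrestr/= setIidl// => y /=.
  by rewrite /D/= !in_itv/= => /andP[-> yx]; rewrite (le_lt_trans yx).
split.
- by rewrite fE.
- have intf y : mu.-integrable `]0, y] (EFin \o (fine \o f)).
    by rewrite fE; apply: integrableS fint.
  have locf : locally_integrable setT (fine \o f).
    by apply: open_integrable_locally; [exact: openT|rewrite fE].
  have := @FTC1 R (fine \o f) (BRight 0) intf locf.
  apply: filterS; first exact: (ae_filter_ringOfSetsType mu).
  move=> x /= H /andP[x0 xs]; have {H} := H _.
  rewrite lte_fin => /(_ x0)[dx dxE].
  pose G (y : R) : R := \int[mu]_(t in `]0, y]) (fine \o f) t.
  apply: (@near_eq_is_derive _ _ _ (fun y : R => F 0 + G y)).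
    have GE y : 0 <= y < s + 1 -> F 0 + G y = F y.
      by move=> ys; rewrite /G -(FE _ ys) addrC subrK.
    near=> y; apply: GE; apply/andP; split.
      by near: y; exact: (cvgr_ge x).
    by near: y; apply: (cvgr_lt x) => //; lra.
  rewrite -[fine (f x)]add0r; apply: is_deriveD.
  apply: DeriveDef; first exact: dx.
  rewrite -derive1E; exact: dxE.
- by move=> x /andP[x0 xs]; apply: FE; rewrite x0/=; lra.
Unshelve. all: by end_near. Qed.

(** Jordan decomposition: [h] is its variation function minus the difference of the two, and both
    are nondecreasing and absolutely continuous. *)
Lemma abs_continuous_density s h : 0 < s -> abs_continuous_on 0 s h ->
  exists f : R -> R, [/\ mu.-integrable setT (EFin \o f),
    {ae mu, forall x, 0 < x < s -> is_derive x (1:R) h (f x)} &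
    h s - h 0 = \int[mu]_(t in `]0, s]) f t].
Proof.
move=> s0 ach; have s0' := ltW s0.
have bvh := abs_continuous_on_bounded_variation s0' ach.
pose T x := fine (total_variation 0 x h).
pose G x := T x - h x.
have TV_fin x : 0 <= x -> x <= s -> total_variation 0 x h \is a fin_num.
  by move=> x0 xs; apply/bounded_variationP => //; exact: bounded_variationl bvh.
have Tinc x y : 0 <= x -> x <= y -> y <= s -> `|h y - h x| <= T y - T x.
  move=> x0 xy ys; rewrite /T (total_variationD h x0 xy).
  have xyfin : total_variation x y h \is a fin_num.
    apply/bounded_variationP => //; apply: (bounded_variationl xy ys).
    by apply: bounded_variationr bvh => //; exact: le_trans ys.
  rewrite fineD ?TV_fin// ?(le_trans xy)// [X in _ <= X - _]addrC addrK -lee_fin fineK//.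
  exact: total_variation_ge.
have acT : abs_continuous_on 0 s T := abs_continuous_on_tv s0' ach.
have acG : abs_continuous_on 0 s G := abs_continuousB acT ach.
have ndT : {homo T \o clamp s : x y / x <= y}.
  move=> x y xy /=; rewrite -subr_ge0.
  exact: le_trans (Tinc _ _ (clamp_ge0 _ _) (le_clamp _ xy) (clamp_le _ s0')).
have ndG : {homo G \o clamp s : x y / x <= y}.
  move=> x y xy /=; rewrite -subr_ge0 /G.
  have := Tinc _ _ (clamp_ge0 _ _) (le_clamp s xy) (clamp_le _ s0').
  by have := ler_norm (h (clamp s y) - h (clamp s x)); lra.
have [fT [ifT dT ET]] := nondecreasing_abs_continuous_density s0 ndT
  (fun a b => abs_continuous_on_clamp a b s0' acT).
have [fG [ifG dG EG]] := nondecreasing_abs_continuous_density s0 ndG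
  (fun a b => abs_continuous_on_clamp a b s0' acG).
have [c0 cs] : clamp s 0 = 0 /\ clamp s s = s by rewrite !clamp_id// ?lexx ?s0'.
exists (fT \- fG); split.
- have -> : EFin \o (fT \- fG) = ((EFin \o fT) \- (EFin \o fG))%E by [].
  exact: integrableB.
- apply: filterS2 dT dG; first exact: (ae_filter_ringOfSetsType mu).
  move=> x dT dG /[dup] x0s /andP[x0 xs].
  apply: (@near_eq_is_derive _ _ _ ((T \o clamp s) \- (G \o clamp s))).
    near=> y; rewrite /= clamp_id /G; first by rewrite opprB addrC subrK.
    apply/andP; split; near: y; [exact: (cvgr_ge x)|exact: (cvgr_le x)].
  by apply: is_deriveB; [exact: dT|exact: dG].
- have := ET s; have := EG s; rewrite /= s0' lexx c0 cs => /(_ erefl) EGs /(_ erefl) ETs.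
  rewrite RintegralB//; [|exact: integrableS ifT|exact: integrableS ifG].
  by rewrite -ETs -EGs /G; ring.
Unshelve. all: by end_near. Qed.

Lemma convex_functionE (psi : R -> R) : @convex_function R R^o setT psi ->
  forall t x y, 0 <= t <= 1 -> psi (t * x + (1 - t) * y) <= t * psi x + (1 - t) * psi y.
Proof.
move=> cpsi t x y /andP[t0 t1].
have := cpsi (Itv01 t0 t1) x y; rewrite !inE => /(_ Logic.I Logic.I).
exact.
Qed.

(** The slope is the supremum of the difference quotients to the left of [a]; convexity puts them
    all below those to the right. *)
Lemma convex_function_subgradient (psi : R -> R) a :
  @convex_function R R^o setT psi ->
  exists m, forall u, psi a + m * (u - a) <= psi u.
Proof.
move=> /convex_functionE cpsi.
have slope x y : x < a -> a < y ->
    (psi a - psi x) / (a - x) <= (psi y - psi a) / (y - a).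
  move=> xa ay.
  have xy : 0 < y - x by lra.
  have := cpsi ((y - a) / (y - x)) x y.
  have -> : (y - a) / (y - x) * x + (1 - (y - a) / (y - x)) * y = a.
    by field; lra.
  have -> : 0 <= (y - a) / (y - x) <= 1.
    by rewrite divr_ge0 ?ler_pdivrMr//=; lra.
  move=> /(_ erefl) H; rewrite ler_pdivrMr ?subr_gt0// mulrAC ler_pdivlMr ?subr_gt0//.
  move: H; have -> : (y - a) / (y - x) * psi x + (1 - (y - a) / (y - x)) * psi y =
    ((y - a) * psi x + (a - x) * psi y) / (y - x) by field; lra.
  by rewrite ler_pdivlMr//; lra.
pose S := [set (psi a - psi x) / (a - x) | x in [set x | x < a]].
have S0 : S !=set0 by exists ((psi a - psi (a - 1)) / (a - (a - 1))), (a - 1) => //=; lra.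
have Sub y : a < y -> ubound S ((psi y - psi a) / (y - a)).
  by move=> ay _ [x /= xa <-]; exact: slope.
have hS : has_sup S by split => //; exists ((psi (a + 1) - psi a) / (a + 1 - a)); apply: Sub; lra.
exists (sup S) => u; have [ua|au|->] := ltgtP u a; last by rewrite subrr mulr0 addr0.
- have : (psi a - psi u) / (a - u) <= sup S by apply: sup_upper_bound => //; exists u.
  by rewrite ler_pdivrMr ?subr_gt0//; lra.
- have : sup S <= (psi u - psi a) / (u - a) by apply: ge_sup => //; exact: Sub.
  by rewrite ler_pdivlMr ?subr_gt0//; lra.
Qed.

(* Jensen's inequality on [0, s], by integrating a supporting line of [psi]. *)
Lemma energy_ge (psi : R -> R) T s h : (forall u, 0 <= psi u) ->
  @convex_function R R^o setT psi -> 0 < s <= T -> abs_continuous_on 0 T h ->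
  ((s * psi ((h s - h 0) / s))%:E <= energy psi T h)%E.
Proof.
move=> psi0 cpsi /andP[s0 sT] achT.
have ach : abs_continuous_on 0 s h.
  move=> e e0; have [delta d0 H] := achT e e0; exists delta => // n x y xy.
  by apply: H => i; have [? [? ys]] := xy i; do 2!split => //; exact: le_trans ys sT.
have [f [intf [N [mN N0 dN]] fE]] := abs_continuous_density s0 ach.
set a := (h s - h 0) / s; have [m psim] := convex_function_subgradient a cpsi.
pose q x := psi a + m * (f x - a).
pose D : set (measurableTypeR R) := `]0, s]%classic.
have mD : measurable D by exact: measurable_itv.
have muD : (mu D < +oo)%E.
  by rewrite [X in (X < _)%E]lebesgue_measure_itv/= lte_fin s0 -EFinB ltry.
have intfD : mu.-integrable D (EFin \o f) by apply: integrableS intf.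
have intc (c : R) : mu.-integrable D (EFin \o cst c).
  by apply: measurable_bounded_integrable => //; exists `|c|; split => // M cM y _ /=; exact: ltW.
have intqE : mu.-integrable D (EFin \o q) /\ \int[mu]_(x in D) q x = s * psi a.
  have intmf : mu.-integrable D (EFin \o (fun x => m * f x)).
    by have := integrableZl mD m intfD; exact: eq_integrable.
  have -> : q = (fun x => cst (psi a - m * a) x + m * f x).
    by apply/funext => x; rewrite /q/=; ring.
  split.
    by have := integrableD mD (intc (psi a - m * a)) intmf; exact: eq_integrable.
  have cE c : \int[mu]_(x in D) cst c x = c * s.
    have e : (\int[mu]_(x in D) (cst c%:E x) = c%:E * mu D)%E := integral_cst _ mD c%:E.
    rewrite /Rintegral /= e.
    rewrite [X in (_ * X)%E]lebesgue_measure_itv/= lte_fin s0/=.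
    by rewrite subr0.
  rewrite RintegralD// RintegralZl// -fE cE /a.
  by field; rewrite gt_eqF.
have [intq qE] := intqE.
(* The density is the derivative only in the open interval, so the endpoint joins the exceptional
   null set. *)
pose N' := N `|` [set s].
have mN' : measurable N' by apply: measurableU.
have N'0 : mu N' = 0%E.
  apply: measure_negligible => //; apply: negligibleU; first by exists N; split.
  by exists [set s]; split => //; exact: lebesgue_measure_set1.
(* The supporting line may be negative. Its positive part has a larger integral and still lies below
   [psi], and being nonnegative it can be compared with the possibly nonmeasurable integrand of
   [energy]. *)
pose qp := ((EFin \o q)^\+)%E.
have qpE x : qp x = maxe (q x)%:E 0 by rewrite /qp funeposE.
have intqp : mu.-integrable D qp by exact: integrable_funepos.
rewrite -qE /Rintegral fineK; last exact: integrable_fin_num.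
apply: (@le_trans _ _ (\int[mu]_(x in D) qp x)%E).
  by apply: le_integral => // x _; rewrite qpE le_max lexx.
rewrite (@negligible_integral _ _ _ mu D N')//.
rewrite /energy integral_mkcond [leRHS]integral_mkcond.
apply: le_integral_of_ge0 => x _.
  by rewrite /patch; case: ifPn => //= _; rewrite qpE le_max lexx orbT.
rewrite /patch; case: ifPn => [|_]; last by case: ifPn => //; rewrite lee_fin.
move=> /set_mem[]; rewrite /D/= in_itv/= => /andP[x0 xs] /not_orP[Nx /eqP xneqs].
rewrite mem_set/=; last by rewrite in_itv/= (ltW x0) (le_trans xs).
rewrite qpE ge_max !lee_fin psi0 andbT.
have [dx dxE] : is_derive x (1:R) h (f x).
  apply: contrapT => nd; apply: Nx; apply: dN => /= H; apply: nd; apply: H.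
  by rewrite x0 lt_neqAle xneqs.
by rewrite derive1E dxE; exact: psim.
Qed.
End AbsolutelyContinuous.

(** * Gaussian tails *)

Section NormalTail.
Variable R : realType.
Local Notation mu := (@lebesgue_measure R).
Variable sigma : R.
Hypothesis sigma0 : 0 < sigma.
Local Notation pdf := (normal_pdf 0 sigma).
Local Notation N := (normal_prob 0 sigma).

Let sigma_neq0 : sigma != 0. Proof. by rewrite gt_eqF. Qed.

(** The quotient of the densities is exp(-x/sigma - 1/2), at most exp(-1/2), and exp(1/2) >= 3/2. *)
Lemma normal_pdf_shift_le x : 0 <= x -> pdf (x + sigma) <= 2 / 3 * pdf x.
Proof.
move=> x0; rewrite !normal_pdfE// mulrCA ler_wpM2l ?normal_peak_ge0//.
rewrite /normal_fun !subr0; set b := - x ^+ 2 / _.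
apply: (@le_trans _ _ (expR (b - 2^-1))).
  rewrite ler_expR -subr_ge0 (_ : _ - _ = x / sigma); last by rewrite /b; field.
  by rewrite divr_ge0// ltW.
rewrite expRD mulrC ler_wpM2r ?expR_ge0// expRN.
rewrite (_ : 2 / 3 = (1 + 2^-1)^-1); last by field.
by rewrite lef_pV2 ?posrE ?expR_gt0// ?expR_ge1Dx//; lra.
Qed.

Lemma normal_pdf_even x : pdf (- x) = pdf x.
Proof. by rewrite !normal_pdfE// /normal_fun !subr0 sqrrN. Qed.

Lemma normal_prob_itv_obnd_cbnd (x : R) : N `]x, +oo[ = N `[x, +oo[.
Proof.
rewrite /normal_prob integral_itv_obnd_cbnd//.
apply/measurable_EFinP/measurable_funTS; exact: measurable_normal_pdf.
Qed.

Lemma normal_tail_shift_le (u : R) : 0 <= u ->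
  (N `](u + sigma)%R, +oo[ <= (2 / 3)%:E * N `]u, +oo[)%E.
Proof.
move=> u0; rewrite !normal_prob_itv_obnd_cbnd /normal_prob.
have := @increasing_ge0_integration_by_substitutiony R (fun x => x + sigma) pdf u.
have dF : (fun x : R => x + sigma)^`()%classic = cst 1.
  by apply/funext => x; rewrite derive1E deriveD// derive_id derive_cst addr0.
have cF : continuous (fun x : R => x + sigma).
  by move=> x; apply: cvgD => //; exact: cvg_cst.
have mpdf (D : set R) : measurable_fun D (fun x => (pdf x)%:E : \bar R).
  by apply/measurable_EFinP/measurable_funTS; exact: measurable_normal_pdf.
have mpdfs (D : set R) : measurable_fun D (fun x => (pdf (x + sigma))%:E : \bar R).
  apply/measurable_EFinP/measurable_funTS.
  apply: measurableT_comp; first exact: measurable_normal_pdf.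
  exact: measurable_funD.
rewrite dF => ->.
- rewrite -ge0_integralZl//; last 2 first.
  + exact: mpdf.
  + by move=> x _; rewrite lee_fin normal_pdf_ge0.
  apply: le_integral_of_ge0 => x; rewrite /= in_itv/= andbT => ux.
    by rewrite mulr1 lee_fin normal_pdf_ge0.
  by rewrite mulr1 -EFinM lee_fin normal_pdf_shift_le// (le_trans u0).
- by move=> x y _ _; rewrite ltrD2r.
- by move=> x _; exact: cst_continuous.
- exact: is_cvg_cst.
- exact: is_cvg_cst.
- split; first by move=> x _; exact: derivableD.
  by apply: cvg_within_filter; exact: cF.
- exact: cvg_addrr.
- by apply: continuous_subspaceT; exact: continuous_normal_pdf.
- by move=> x _; exact: normal_pdf_ge0.
Qed.

Lemma normal_prob_opp (A : set R) : measurable A -> N (-%R @^-1` A) = N A.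
Proof.
move=> mA.
have mopp : measurable_fun setT (-%R : measurableTypeR R -> measurableTypeR R).
  exact: oppr_measurable.
pose m1 : {measure set (measurableTypeR R) -> \bar R} := distribution N (mfun_of mopp).
apply: (@measure_unique _ R (measurableTypeR R) (@ocitv R) (fun n => `](- n%:R)%R, n%:R]%classic) _ _ _ _ m1 N) => //.
- exact: ocitvI.
- by move=> n; exact: is_ocitv.
- exact: (bigcup_itvT false false).
- move=> _ [[a b] _ <-]; rewrite /m1/= /distribution/= /pushforward/=.
  have [ab|ba] := leP a b; last first.
    by rewrite set_itv_ge ?preimage_set0 ?measure0// bnd_simp -leNgt ltW.
  have -> : -%R @^-1` `]a, b]%classic = `[(- b)%R, (- a)%R[%classic :> set R.
    by apply/seteqP; split => x /=; rewrite !in_itv/= => /andP[? ?]; apply/andP; split; lra.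
  have mpdf (D : set R) : measurable_fun D (fun x => (pdf x)%:E : \bar R).
    by apply/measurable_EFinP/measurable_funTS; exact: measurable_normal_pdf.
  rewrite /normal_prob integral_itv_bndo_bndc; last exact: mpdf.
  rewrite (@integration_by_substitution_oppr _ _ _ _ ab); last first.
    by apply: continuous_subspaceT; exact: continuous_normal_pdf.
  rewrite integral_itv_obnd_cbnd; last exact: mpdf.
  by apply: eq_integral => x _; rewrite -[in RHS]normal_pdf_even.
- move=> n; rewrite (@le_lt_trans _ _ 1%E)//; last exact: ltry.
  exact: probability_le1.
Qed.

Lemma normal_integral_opp (f : R -> R) : measurable_fun setT f -> (forall x, 0 <= f x) ->
  (\int[N]_x (f (- x))%:E = \int[N]_x (f x)%:E)%E.
Proof.
move=> mf f0.
have mopp : measurable_fun setT (-%R : measurableTypeR R -> measurableTypeR R).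
  exact: oppr_measurable.
rewrite -[RHS](@eq_measure_integral _ _ _ _ _ (distribution N (mfun_of mopp))); last first.
  by move=> A mA _; exact: normal_prob_opp.
by rewrite ge0_integral_distribution//; exact/measurable_EFinP.
Qed.

(* Shifting a half-line by [sigma] multiplies its mass by at most 2/3, so the
   tail integral is dominated by a geometric series. *)
Lemma normal_overshoot (u : R) : 0 <= u ->
  (\int[N]_x (Num.max (x - u) 0)%:E <= (3 * sigma)%:E * N `]u, +oo[)%E.
Proof.
move=> u0.
(* The constant 3 is the sum of the geometric series of ratio 2/3. The induction moves the starting
   point, so [v] stays general. *)
have tail n (v : R) : 0 <= v ->
    (\sum_(k < n) N `](v + k%:R * sigma)%R, +oo[ <= 3%:E * N `]v, +oo[)%E.
  elim: n v => [|n ih] v v0; first by rewrite big_ord0 mule_ge0// lee_fin.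
  rewrite big_ord_recl mul0r addr0.
  have vs0 : 0 <= v + sigma by rewrite addr_ge0// ltW.
  apply: (@le_trans _ _ (N `]v, +oo[ + 3%:E * N `](v + sigma)%R, +oo[)%E).
    rewrite leeD2l// (le_trans _ (ih _ vs0))//.
    apply: lee_sum => k _; rewrite lift0 -natr1 mulrDl mul1r (addrC _ sigma) addrA.
    by [].
  apply: (@le_trans _ _ (N `]v, +oo[ + 3%:E * ((2 / 3)%:E * N `]v, +oo[))%E).
    by rewrite leeD2l// lee_wpmul2l ?lee_fin// normal_tail_shift_le.
  rewrite muleA -EFinM -{1}[N _]mul1e -ge0_muleDl ?lee_fin// -EFinD.
  by rewrite (_ : 1 + 3 * (2 / 3) = 3 :> R)//; field.
pose I k : set R := `](u + k%:R * sigma)%R, +oo[%classic.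
have mI k : measurable_fun setT (fun x : R => (\1_(I k) x)%:E : \bar R).
  by apply/measurable_EFinP/measurable_indic; exact: measurable_itv.
(* The overshoot of [x] above [u], cut off at [n * sigma], is at most [sigma] times the number of
   levels [u + k * sigma] with k < n that lie below [x]. *)
have pointwise x n : Num.min (x - u) (n%:R * sigma) <= \sum_(0 <= k < n) sigma * \1_(I k) x.
  elim: n => [|n ih]; first by rewrite big_nil mul0r ge_min lexx orbT.
  rewrite big_nat_recr//= indicE; have [xn|xn] := leP x (u + n%:R * sigma).
    have -> : (x \in I n) = false by apply/negbTE; rewrite notin_setE /I/= in_itv/= andbT; apply/negP; rewrite -leNgt.
    rewrite mulr0 addr0; apply: le_trans ih; rewrite le_min; apply/andP; split.
      by rewrite ge_min lexx.
    by rewrite ge_min; apply/orP; left; lra.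
  have -> : x \in I n by rewrite inE /I/= in_itv/= andbT.
  rewrite mulr1 ge_min -natr1 mulrDl mul1r lerD2r; apply/orP; right.
  by apply: le_trans ih; rewrite le_min lexx andbT; lra.
apply: (@le_trans _ _ (\int[N]_x \big[+%E/0%E]_(0 <= k <oo) (sigma%:E * (\1_(I k) x)%:E))%E).
  apply: le_integral_of_ge0 => x _; first by rewrite lee_fin le_max lexx orbT.
  pose n := Num.bound ((x - u) / sigma).
  apply: (@le_trans _ _ (\sum_(0 <= k < n) sigma%:E * (\1_(I k) x)%:E)%E); last first.
    by apply: nneseries_lim_ge => k _; rewrite mule_ge0// lee_fin// ltW.
  under eq_bigr do rewrite -EFinM.
  rewrite sumEFin lee_fin ge_max sumr_ge0 ?andbT; last first.
    by move=> k _; rewrite mulr_ge0// ltW.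
  apply: le_trans (pointwise x n); rewrite le_min lexx/= -ler_pdivrMr//.
  rewrite (le_trans (ler_norm _))// ltW//.
  by have := archi_boundP (normr_ge0 ((x - u) / sigma)); rewrite /n /Num.Def.archi_bound normr_id.
rewrite integral_nneseries//; last 2 first.
- by move=> k; apply: measurable_funeM; exact: mI.
- by move=> k x _; rewrite mule_ge0// lee_fin// ltW.
apply: lime_le.
  by apply: is_cvg_nneseries => k _ _; apply: integral_ge0 => x _; rewrite mule_ge0// lee_fin// ltW.
apply: nearW => n; rewrite big_mkord.
apply: (@le_trans _ _ (\sum_(k < n) sigma%:E * N (I k))%E).
  apply: lee_sum => k _; rewrite (ge0_integralZl N measurableT (mI k))//; last by rewrite lee_fin ltW.
  rewrite integral_indic ?setIT//; exact: measurable_itv.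
rewrite -ge0_sume_distrr// (mulrC 3) EFinM -muleA; apply: lee_wpmul2l; first by rewrite lee_fin ltW.
exact: tail.
Qed.

(** Since the mean is 0, the positive part of u - x exceeds that of x - u by [u] on average. To
    integrate nonnegative functions only, this is derived from the identity (u-x)^+ + (u+x)^+ = 2u +
    (x-u)^+ + (-x-u)^+ and the symmetry of the law. *)
Lemma normal_positive_part (u : R) : 0 <= u ->
  (\int[N]_x (Num.max (u - x) 0)%:E <= u%:E + (3 * sigma)%:E * N `]u, +oo[)%E.
Proof.
move=> u0; have ovu := normal_overshoot u0.
set K := (_ + _)%E; set I := (\int[N]_x _)%E.
pose J := (\int[N]_x (Num.max (x - u) 0)%:E)%E.
have mmax1 : measurable_fun setT (fun x : R => Num.max (u - x) 0).
  by apply: measurable_maxr => //; exact: measurable_funB.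
have mmax2 : measurable_fun setT (fun x : R => Num.max (x - u) 0).
  by apply: measurable_maxr => //; exact: measurable_funB.
have mmax3 : measurable_fun setT (fun x : R => Num.max (u - - x) 0).
  by apply: measurable_maxr => //; do 2 apply: measurable_funB => //.
have mmax4 : measurable_fun setT (fun x : R => Num.max (- x - u) 0).
  by apply: measurable_maxr => //; do 2 apply: measurable_funB => //.
have I2 : (\int[N]_x (Num.max (u - - x) 0)%:E)%E = I.
  by apply: (normal_integral_opp mmax1) => x; rewrite le_max lexx orbT.
have J2 : (\int[N]_x (Num.max (- x - u) 0)%:E)%E = J.
  by apply: (normal_integral_opp mmax2) => x; rewrite le_max lexx orbT.
have IJ : (I + I = (2 * u)%:E + (J + J))%E.
  rewrite -{2}I2 -{2}J2 /I /J -ge0_integralD//; last 4 first.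
  - by move=> x _; rewrite lee_fin le_max lexx orbT.
  - exact/measurable_EFinP.
  - by move=> x _; rewrite lee_fin le_max lexx orbT.
  - exact/measurable_EFinP.
  rewrite -ge0_integralD//; last 4 first.
  - by move=> x _; rewrite lee_fin le_max lexx orbT.
  - exact/measurable_EFinP.
  - by move=> x _; rewrite lee_fin le_max lexx orbT.
  - exact/measurable_EFinP.
  have max0 v : 0 <= Num.max v 0 :> R by rewrite le_max lexx orbT.
  have -> : (2 * u)%:E = (\int[N]_x (cst (2 * u)%:E x))%E.
    by rewrite integral_cst// [X in (_ * X)%E]probability_setT mule1.
  rewrite -ge0_integralD//; try by [move=> x _; rewrite lee_fin mulr_ge0 |
    exact: measurable_cst | move=> x _; rewrite adde_ge0// lee_fin |
    apply: emeasurable_funD; exact/measurable_EFinP].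
  apply: eq_integral => x _; rewrite /= -!EFinD; congr EFin.
  move: (x : R) => {}x; rewrite /Order.max.
  by case: ifPn; case: ifPn; case: ifPn; case: ifPn; rewrite -?leNgt => *; lra.
have J0 : (0 <= J)%E by apply: integral_ge0 => x _; rewrite lee_fin le_max lexx orbT.
have I0 : (0 <= I)%E by apply: integral_ge0 => x _; rewrite lee_fin le_max lexx orbT.
have JK : (J <= (3 * sigma)%:E * N `]u, +oo[)%E by [].
have Nfin : N `]u, +oo[ \is a fin_num by exact: fin_num_measure.
have Jfin : J \is a fin_num.
  by rewrite ge0_fin_numE// (le_lt_trans JK)// lte_mul_pinfty ?lee_fin ?mulr_ge0 ?ltW//; rewrite -ge0_fin_numE.
have Ifin : I \is a fin_num.
  rewrite ge0_fin_numE// (@le_lt_trans _ _ (I + I)%E) ?leeDl// IJ.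
  by rewrite lte_add_pinfty ?ltry// lte_add_pinfty// -ge0_fin_numE.
rewrite /K (le_trans _ (leeD2l _ JK))//.
move: IJ; rewrite -(fineK Ifin) -(fineK Jfin) -!EFinD => -[IJ].
by rewrite lee_fin; lra.
Qed.

(** On [-2 sigma, -sigma], of length [sigma], the density is at least its peak times exp(-2). The
    bound does not depend on [sigma]. *)
Lemma normal_lower_tail :
  ((expR (-2) / Num.sqrt (pi *+ 2))%:E <= N `]-oo, (- sigma)%R])%E.
Proof.
pose D : set R := `[(- (2 * sigma))%R, (- sigma)%R]%classic.
have Dlow : D `<=` `]-oo, (- sigma)%R]%classic by move=> x /=; rewrite !in_itv/= => /andP[].
have mN (B : set R) : measurable_fun B (fun x => (pdf x)%:E : \bar R).
  by apply/measurable_EFinP/measurable_funTS; exact: measurable_normal_pdf.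
pose c := normal_peak sigma * expR (- 2).
apply: (@le_trans _ _ (N D)); last first.
  by apply: le_measure => //; rewrite inE; exact: measurable_itv.
apply: (@le_trans _ _ (\int[mu]_(x in D) cst c%:E x)%E).
  have mD : measurable (D : set (measurableTypeR R)) by exact: measurable_itv.
  have -> : (\int[mu]_(x in D) cst c%:E x = c%:E * mu D)%E := integral_cst _ mD c%:E.
  rewrite [X in (_ * X)%E]lebesgue_measure_itv/= lte_fin.
  rewrite ifT; last by rewrite ltrN2 ltr_pMl// ltr1n.
  rewrite -EFinB -EFinM lee_fin /c /normal_peak -mulrnAr sqrtrM ?sqr_ge0// sqrtr_sqr gtr0_norm//.
  have : 0 < Num.sqrt (pi *+ 2) :> R by rewrite sqrtr_gt0 pmulrn_lgt0// pi_gt0.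
  set q := Num.sqrt _ => q0.
  by rewrite le_eqVlt; apply/orP; left; apply/eqP; field; rewrite !gt_eqF.
rewrite /normal_prob; apply: le_integral_of_ge0 => x.
  by move=> _; rewrite lee_fin mulr_ge0 ?normal_peak_ge0 ?expR_ge0.
rewrite /D/= in_itv/= => /andP[x1 x2].
rewrite lee_fin normal_pdfE// /c ler_wpM2l ?normal_peak_ge0// ler_expR subr0.
rewrite mulNr lerN2 ler_pdivrMr; last by rewrite pmulrn_lgt0// exprn_gt0.
move: (x : R) x1 x2 => {}x x1 x2; rewrite -mulr_natr; nra.
Qed.
End NormalTail.

(** * Random walks below a barrier *)

Lemma measurable_le_preimage d (T : measurableType d) (R : realType) (f : T -> R) y :
  measurable_fun setT f -> measurable [set w | f w <= y].
Proof.
move=> mf; rewrite (_ : [set w | _] = f @^-1` `]-oo, y]).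
  by rewrite -[X in measurable X]setTI; exact: mf.
by apply/seteqP; split => w; rewrite /= in_itv.
Qed.

(** * Independence of a state from later increments *)

Section Independence.
Context d (Omega : measurableType d) (R : realType) (P : probability Omega R).
Implicit Types (X Y : Omega -> R).

Lemma measure_prod_unique (m1 m2 : {measure set (R * R) -> \bar R}) :
  (m1 setT < +oo)%E ->
  (forall A B : set R, measurable A -> measurable B -> m1 (A `*` B) = m2 (A `*` B)) ->
  forall D, measurable D -> m1 D = m2 D.
Proof.
move=> m1oo m12 D mD.
apply: (measure_unique [set A `*` B | A in measurable & B in measurable] (fun=> setT)) => //.
- by rewrite measurable_prod_measurableType.
- move=> _ _ [A mA [B mB <-]] [A' mA' [B' mB' <-]]; rewrite -setXI.
  exists (A `&` A'); first exact: measurableI.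
  by exists (B `&` B') => //; exact: measurableI.
- by move=> _; exists setT => //; exists setT => //; rewrite setXTT.
- by rewrite bigcup_const//; exists 0%N.
- by move=> _ [A mA [B mB <-]]; exact: m12.
Qed.

Lemma measurable_preimage X (C : set R) : measurable_fun setT X -> measurable C ->
  measurable (X @^-1` C).
Proof. by move=> mX mC; rewrite -[X in measurable X]setTI; exact: mX. Qed.

Lemma measurable_pair_preimage X Y (D : set (R * R)) : measurable_fun setT X ->
  measurable_fun setT Y -> measurable D ->
  measurable ((fun w => (X w, Y w)) @^-1` D).
Proof.
move=> mX mY mD; rewrite -[X in measurable X]setTI.
by apply: measurable_fun_pair => //.
Qed.

Definition indep2 Y X := forall B C : set R, measurable B -> measurable C ->
  P (Y @^-1` B `&` X @^-1` C) = (P (Y @^-1` B) * P (X @^-1` C))%E.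

Section Pair.
Variables (X Y : Omega -> R) (mX : measurable_fun setT X) (mY : measurable_fun setT Y).
Hypothesis YX : indep2 Y X.
Let muX := distribution P (mfun_of mX).
Let muY := distribution P (mfun_of mY).
Let muYX := distribution P (mfun_of (measurable_fun_pair mY mX)).

Let muYXE D : measurable D -> muYX D = (muY \x muX)%E D.
Proof.
apply: measure_prod_unique => [|A B mA mB].
  by apply: (@le_lt_trans _ _ 1%E); [exact: probability_le1|exact: ltry].
transitivity (P (Y @^-1` A) * P (X @^-1` B))%E; first exact: YX.
by rewrite [RHS]product_measure1E.
Qed.

Lemma integral_indep2 (f : R * R -> \bar R) : measurable_fun setT f ->
  (forall z, 0 <= f z)%E ->
  (\int[P]_w f (Y w, X w) = \int[muY]_y \int[muX]_x f (y, x))%E.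
Proof.
move=> mf f0; rewrite -fubini_tonelli1//.
rewrite -(@eq_measure_integral _ _ _ _ _ muYX); last by move=> D mD _; exact: muYXE.
by rewrite ge0_integral_distribution.
Qed.

(** With the increment in the outer integral, an inequality about the state can be applied for each
    fixed value of the increment. *)
Lemma integral_indep2_swap (f : R * R -> \bar R) : measurable_fun setT f ->
  (forall z, 0 <= f z)%E ->
  (\int[P]_w f (Y w, X w) = \int[muX]_x \int[P]_w f (Y w, x))%E.
Proof.
move=> mf f0; rewrite integral_indep2// fubini_tonelli//.
apply: eq_integral => x _; rewrite ge0_integral_distribution//.
apply: (@measurableT_comp _ _ _ _ _ _ f _ (fun y => (y, x)) mf).
exact: measurable_fun_pair.
Qed.

Lemma probability_indep2_swap (D : set (R * R)) : measurable D ->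
  P [set w | D (Y w, X w)] = (\int[muX]_x P [set w | D (Y w, x)])%E.
Proof.
move=> mD; have mf : measurable_fun setT (fun z => (\1_D z)%:E : \bar R).
  by apply/measurable_EFinP; exact: measurable_indic.
have := integral_indep2_swap mf; rewrite (_ : (\int[P]_w _)%E = P [set w | D (Y w, X w)]).
  move=> ->; last by move=> z; rewrite lee_fin.
  apply: eq_integral => x _.
  have mDx : measurable [set w | D (Y w, x)].
    by have := measurable_pair_preimage mY (measurable_cst x) mD.
  transitivity (\int[P]_w (\1_[set w | D (Y w, x)] w)%:E)%E; first by [].
  by rewrite integral_indic// setIT.
have mDX : measurable [set w | D (Y w, X w)] by exact: (measurable_pair_preimage mY mX mD).
transitivity (\int[P]_w (\1_[set w | D (Y w, X w)] w)%:E)%E; first by [].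
by rewrite integral_indic// setIT.
Qed.
End Pair.

Variables (X : nat -> Omega -> R) (mX : forall n, measurable_fun setT (X n)).

(** Independence of [Y] from all increments with index at least [n], expressed on product events so
    that no filtration has to be built. *)
Definition indep_from Y n := forall k (C : set R) (B : nat -> set R),
  measurable C -> (forall i, measurable (B i)) ->
  P (Y @^-1` C `&` \bigcap_(i < k) X (n + i)%N @^-1` B i) =
  (P (Y @^-1` C) * \prod_(i < k) P (X (n + i)%N @^-1` B i))%E.

Lemma indep_from2 Y n : indep_from Y n -> indep2 Y (X n).
Proof.
move=> YX B C mB mC; have := YX 1%N B (fun=> C) mB (fun=> mC).
rewrite big_ord1 addn0 => <-; congr (P (_ `&` _)).
by apply/seteqP; split => w /=; [move=> XC i /= ; rewrite ltnS leqn0 => /eqP ->|move=> /(_ 0%N)]; rewrite addn0//; exact.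
Qed.

(** With the future event [F] fixed, both sides are finite measures in the set of values of the pair
    (Y, X n): the law of the pair restricted to [F], and that law times the product of the future
    probabilities. They agree on rectangles, hence everywhere, in particular on the preimage of [C]
    under [phi]. *)
Lemma indep_fromS Y n (phi : R * R -> R) : measurable_fun setT Y ->
  measurable_fun setT phi ->
  indep_from Y n -> indep_from (fun w => phi (Y w, X n w)) n.+1.
Proof.
move=> mY mphi YX k C B mC mB.
pose F := \bigcap_(i < k) X (n.+1 + i)%N @^-1` B i.
have mF : measurable F.
  by apply: bigcap_measurableType => // i _; exact: measurable_preimage.
pose pF := (\prod_(i < k) P (X (n.+1 + i)%N @^-1` B i))%E.
have FE (A C' : set R) : measurable A -> measurable C' ->
    P (Y @^-1` A `&` X n @^-1` C' `&` F) = (P (Y @^-1` A) * P (X n @^-1` C') * pF)%E.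
  move=> mA mC'; pose B' i := if i is j.+1 then B j else C'.
  have mB' i : measurable (B' i) by case: i.
  have := YX k.+1 A B' mA mB'; rewrite big_ord_recl/= addn0 muleA => E.
  rewrite /pF; under eq_bigr do rewrite addSnnS.
  rewrite -E -setIA; congr (P (_ `&` _)); apply/seteqP; split => w /=.
    move=> [XC Fw] [_|i ik]; first by rewrite addn0.
    by have := Fw i ik; rewrite /= addSnnS.
  move=> H; split; first by have := H 0%N; rewrite /= addn0; exact.
  by move=> i ik; have := H i.+1 ik; rewrite /= addSnnS.
have pF0 : (0 <= pF)%E by apply: prode_ge0 => i _; exact: measure_ge0.
have pFfin : pF \is a fin_num.
  apply: prode_fin_num => i _.
  by apply: fin_num_measure; exact: measurable_preimage.
have YXn := indep_from2 YX.
pose pYX w := (Y w, X n w).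
have mpYX : measurable_fun setT pYX by exact: measurable_fun_pair.
pose m1' : {measure set (R * R) -> \bar R} := pushforward (mrestr P mF) pYX.
pose m1 := m1' mpYX.
pose m2' : {measure set (R * R) -> \bar R} := mscale (NngNum (fine_ge0 pF0)) (pushforward P pYX).
pose m2 := m2' mpYX.
have m1E D : m1 D = P (pYX @^-1` D `&` F) by [].
have m2E D : m2 D = (pF * P (pYX @^-1` D))%E.
  by rewrite -[in RHS](fineK pFfin).
have m12 D : measurable D -> m1 D = m2 D.
  apply: measure_prod_unique => [|A C' mA mC'].
    rewrite m1E (@le_lt_trans _ _ (P setT))//; last by rewrite probability_setT ltry.
    by apply: le_measure; rewrite ?inE//; apply: measurableI => //; rewrite preimage_setT.
  rewrite m1E m2E muleC -[X in (X * pF)%E]/(P (Y @^-1` A `&` X n @^-1` C')) YXn//.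
  exact: FE.
have := m12 (phi @^-1` C); rewrite m1E m2E muleC; apply.
by rewrite -[X in measurable X]setTI; exact: mphi.
Qed.
End Independence.

(** * Survival of a random walk below a nondecreasing barrier *)

Section KilledWalk.
Context d (Omega : measurableType d) (R : realType) (P : probability Omega R).
Variables (X : nat -> Omega -> R) (mX : forall n, measurable_fun setT (X n)).
Hypothesis X_indep : forall n (A : nat -> set R), (forall i, measurable (A i)) ->
  P (\bigcap_(i < n) X i @^-1` A i) = (\prod_(i < n) P (X i @^-1` A i))%E.
Variable b : nat -> R.
Hypothesis b0 : 0 <= b 0%N.
Hypothesis b_nd : forall n, b n <= b n.+1.

Definition partial_sum n (w : Omega) : R := \sum_(i < n) X i w.

(** The value [b n.+1 + 1] marks a killed walk: it lies above the barrier, so the test at the next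
    step fails and killing is permanent. The state remains a real number computed from the previous
    state and one increment, the form [indep_fromS] asks for. *)
Definition kill_step n (z : R * R) : R :=
  if (z.1 <= b n) && (z.1 + z.2 <= b n.+1) then z.1 + z.2 else b n.+1 + 1.

(* The walk with increments [X], sent above the barrier [b] forever once it
   exceeds it. *)
Fixpoint killed_walk n (w : Omega) : R :=
  if n is m.+1 then kill_step m (killed_walk m w, X m w) else 0.

Lemma killed_walk_leP n w :
  killed_walk n w <= b n <-> (forall i, (i <= n)%N -> partial_sum i w <= b i).
Proof.
suff H : (killed_walk n w <= b n -> killed_walk n w = partial_sum n w) /\
    (killed_walk n w <= b n <-> (forall i, (i <= n)%N -> partial_sum i w <= b i)).
  by case: H.
elim: n => [|n [ihE ih]].
  rewrite /= /partial_sum big_ord0; split => //; split => // _ i.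
  by rewrite leqn0 => /eqP ->; rewrite big_ord0.
have SE : partial_sum n.+1 w = partial_sum n w + X n w by rewrite /partial_sum big_ord_recr.
rewrite /= /kill_step/=; case: ifPn => [/andP[Zb Zb']|/nandP Zb].
  rewrite SE -ihE//; split => //; split => // _ i.
  rewrite leq_eqVlt => /predU1P[->|]; first by rewrite SE -ihE.
  by move/ih: Zb; exact.
have bF : (b n.+1 + 1 <= b n.+1) = false by apply/negbTE; rewrite -ltNge ltrDl.
rewrite bF; split => //; split => // H.
have Zb1 : killed_walk n w <= b n by apply/ih => i iN; apply: H; exact: leqW.
case: Zb => [/negP//|]; rewrite ihE// -SE => /negP; rewrite H//.
Qed.

Lemma measurable_add : measurable_fun setT (fun z : R * R => z.1 + z.2).
Proof. by apply: measurable_funD; [exact: measurable_fst|exact: measurable_snd]. Qed.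

Lemma measurable_kill_step n : measurable_fun setT (kill_step n).
Proof.
apply: measurable_fun_ifT => //.
  apply: measurable_and; apply: measurable_fun_ler => //; exact: measurable_add.
exact: measurable_add.
Qed.

Lemma kill_step_le n z y : y <= b n.+1 ->
  (kill_step n z <= y) = (z.1 <= b n) && (z.1 + z.2 <= y).
Proof.
move=> yb; rewrite /kill_step; case: ifPn => [/andP[-> _]//|].
have -> : (b n.+1 + 1 <= y) = false by apply/negbTE; rewrite -ltNge (le_lt_trans yb)// ltrDl.
rewrite negb_and => /orP[/negbTE ->//|]; rewrite -ltNge => zb.
by apply/esym/negbTE; rewrite negb_and -!ltNge (le_lt_trans yb zb) orbT.
Qed.

Lemma measurable_killed_walk n : measurable_fun setT (killed_walk n).
Proof.
elim: n => [|n ih]; first exact: measurable_cst.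
apply: (@measurableT_comp _ _ _ _ _ _ (kill_step n)); first exact: measurable_kill_step.
exact: measurable_fun_pair.
Qed.

Lemma measurable_partial_sum n : measurable_fun setT (partial_sum n).
Proof. by apply: measurable_sum => i; exact: mX. Qed.

Lemma indep_from0 : indep_from P X (fun=> 0) 0.
Proof.
move=> k C B mC mB; have [C0|nC0] := pselect (C 0).
  have -> : (fun _ : Omega => 0) @^-1` C = setT by apply/seteqP; split.
  by rewrite setTI probability_setT mul1e -X_indep.
have -> : (fun _ : Omega => 0) @^-1` C = set0 by apply/seteqP; split.
by rewrite set0I measure0 mul0e.
Qed.

Lemma indep_killed_walk n : indep_from P X (killed_walk n) n.
Proof.
elim: n => [|n ih]; first exact: indep_from0.
exact: (indep_fromS mX (measurable_killed_walk n) (measurable_kill_step n) ih).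
Qed.

Lemma indep_partial_sum n : indep_from P X (partial_sum n) n.
Proof.
elim: n => [|n ih].
  have -> : partial_sum 0 = fun=> 0 by apply/funext => w; rewrite /partial_sum big_ord0.
  exact: indep_from0.
have := indep_fromS mX (measurable_partial_sum n) measurable_add ih.
by congr (indep_from _ _ _ _); apply/funext => w; rewrite /partial_sum big_ord_recr.
Qed.

Definition survival n : \bar R := P [set w | killed_walk n w <= b n].
(** Only surviving paths contribute, because a killed walk sits above the barrier. *)
Definition gap n : \bar R := (\int[P]_w (Num.max (b n - killed_walk n w) 0)%:E)%E.

Lemma barrier_ge0 n : 0 <= b n.
Proof. by elim: n => // n; move/le_trans; apply. Qed.

(* Conditioning on survival only pushes the walk down. *)
Lemma killed_walk_dominated n x :
  (survival n * P [set w | (partial_sum n w <= x)%R] <=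
   P [set w | (killed_walk n w <= Num.min x (b n))%R])%E.
Proof.
elim: n x => [x|n ih x].
  rewrite /survival/= b0.
  have -> : [set _ : Omega | true] = setT by apply/seteqP; split.
  rewrite probability_setT mul1e le_measure ?inE//.
  - by apply: measurable_le_preimage; exact: measurable_partial_sum.
  - have [x0|x0] := leP 0 (Num.min x (b 0%N)).
      by rewrite (_ : [set _ | _] = setT)//; apply/seteqP; split.
    by rewrite (_ : [set _ | _] = set0)//; apply/seteqP; split.
  - by move=> w; rewrite /= /partial_sum big_ord0 le_min b0 andbT.
have mZ := measurable_killed_walk n.
have mS := measurable_partial_sum n.
have mle (Y : Omega -> R) y := @measurable_le_preimage _ _ _ Y y.
have SP : (survival n.+1 <= survival n)%E.
  rewrite /survival le_measure ?inE//; [exact: mle (measurable_killed_walk _)|exact: mle|].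
  by move=> w /=; rewrite kill_step_le// => /andP[].
(* Conditionally on X n = z this is the induction hypothesis at level y - z. *)
have step y : y <= b n.+1 ->
    (survival n * P [set w | (partial_sum n.+1 w <= y)%R] <=
     P [set w | (killed_walk n.+1 w <= y)%R])%E.
  move=> yb.
  pose D := [set z : R * R | z.1 + z.2 <= y].
  pose D' := [set z : R * R | (z.1 <= b n) && (z.1 + z.2 <= y)].
  have mD : measurable D by apply: measurable_le_preimage; exact: measurable_add.
  have mD' : measurable D'.
    rewrite (_ : D' = [set z : R * R | z.1 <= b n] `&` D).
      by apply: measurableI => //; exact: measurable_le_preimage.
    by apply/seteqP; split => z; rewrite /D'/D/=; [move/andP => []|move=> [? ?]; apply/andP].
  have -> : [set w | killed_walk n.+1 w <= y] = [set w | D' (killed_walk n w, X n w)].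
    by apply/seteqP; split => w /=; rewrite kill_step_le.
  have -> : [set w | partial_sum n.+1 w <= y] = [set w | D (partial_sum n w, X n w)].
    by apply/seteqP; split => w /=; rewrite /D/= /partial_sum big_ord_recr.
  rewrite (probability_indep2_swap (mX n) mS (indep_from2 (indep_partial_sum n)))//.
  rewrite (probability_indep2_swap (mX n) mZ (indep_from2 (indep_killed_walk n)))//.
  have mP (Y : Omega -> R) (E : set (R * R)) : measurable_fun setT Y -> measurable E ->
      measurable_fun setT (fun x => P [set w | E (Y w, x)]).
    move=> mY mE; have := measurable_fun_ysection (distribution P (mfun_of mY)) mE.
    congr (measurable_fun _ _); apply/funext => z /=.
    by rewrite /distribution /pushforward/=; congr (P _); apply/seteqP; split => w /=; rewrite /ysection/= inE.
  rewrite -ge0_integralZl//; last exact: mP.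
  apply: ge0_le_integral => //.
  - by move=> z _; rewrite mule_ge0.
  - by apply: measurable_funeM; exact: mP.
  - exact: mP.
  - move=> z _; have := ih (y - z).
    congr (survival n * P _ <= P _)%E; apply/seteqP; split => w; rewrite /D /D'/= ?le_min lerBrDr//.
      by move=> /andP[-> ->].
    by move=> /andP[-> ->].
(* Above the barrier the minimum is [b n.+1], so the right side is the survival probability
   itself. *)
have [xb|bx] := leP x (b n.+1).
  apply: le_trans (step x xb); rewrite lee_wpmul2r//.
rewrite -[leRHS]mule1 lee_wpmul2l//.
by apply: probability_le1; exact: mle (measurable_partial_sum _).
Qed.

(* Each killing step overshoots the barrier by at most [C] on average; apart
   from this the gap only grows with the barrier, while the walk is alive. *)
Lemma gapS n (C : R) :
  (forall u : R, 0 <= u ->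
     (\int[distribution P (mfun_of (mX n))]_x (Num.max (u - x) 0)%:E <=
      u%:E + C%:E * P (X n @^-1` `]u, +oo[))%E) ->
  0 <= C ->
  (gap n.+1 + C%:E * survival n.+1 <=
   gap n + C%:E * survival n + (b n.+1 - b n)%:E * survival n)%E.
Proof.
move=> overshoot C0.
have mZ := measurable_killed_walk n.
have b'0 := barrier_ge0 n.+1.
pose F z := (Num.max (b n.+1 - kill_step n z) 0)%:E.
(* For a living state y, [overshoot] at u = b n.+1 - y bounds the next gap by three terms: the
   present gap, the rise of the barrier, and [C] times the probability of being killed at this
   step. *)
pose G1 (z : R * R) : \bar R := (Num.max (b n - z.1) 0)%:E.
pose D2 := [set z : R * R | z.1 <= b n].
pose D3 := [set z : R * R | (z.1 <= b n) && (b n.+1 < z.1 + z.2)].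
pose G2 z : \bar R := ((b n.+1 - b n)%:E * (\1_D2 z)%:E)%E.
pose G3 z : \bar R := (C%:E * (\1_D3 z)%:E)%E.
have mD2 : measurable D2 by exact: measurable_le_preimage.
have mD3 : measurable D3.
  rewrite (_ : D3 = D2 `&` (fun z : R * R => z.1 + z.2) @^-1` `]b n.+1, +oo[).
    apply: measurableI => //; rewrite -[X in measurable X]setTI.
    by apply: measurable_add.
  by apply/seteqP; split => z; rewrite /D2/D3/= in_itv/= andbT; [move/andP => []|move=> [? ?]; apply/andP].
have mF : measurable_fun setT F.
  apply/measurable_EFinP; apply: measurable_maxr => //; apply: measurable_funB => //.
  exact: measurable_kill_step.
have mG1 : measurable_fun setT G1.
  by apply/measurable_EFinP; apply: measurable_maxr => //; apply: measurable_funB.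
have mG2 : measurable_fun setT G2.
  by apply: measurable_funeM; apply/measurable_EFinP; exact: measurable_indic.
have mG3 : measurable_fun setT G3.
  by apply: measurable_funeM; apply/measurable_EFinP; exact: measurable_indic.
have G10 z : (0 <= G1 z)%E by rewrite lee_fin le_max lexx orbT.
have G20 z : (0 <= G2 z)%E by rewrite mule_ge0// lee_fin// subr_ge0.
have G30 z : (0 <= G3 z)%E by rewrite mule_ge0// lee_fin//.
have F0 z : (0 <= F z)%E by rewrite lee_fin le_max lexx orbT.
pose G z : \bar R := (G1 z + (G2 z + G3 z))%E.
have mG : measurable_fun setT G by apply: emeasurable_funD => //; exact: emeasurable_funD.
have YX := indep_from2 (indep_killed_walk n).
have mZX : measurable_fun setT (fun w => (killed_walk n w, X n w)) by exact: measurable_fun_pair.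
have mcomp (f : R * R -> \bar R) : measurable_fun setT f ->
    measurable_fun setT (fun w => f (killed_walk n w, X n w)).
  by move=> mf; exact: (measurableT_comp mf mZX).
have int_ind D : measurable D ->
    (\int[P]_w (\1_D (killed_walk n w, X n w))%:E)%E = P [set w | D (killed_walk n w, X n w)].
  move=> mD; have mD' := measurable_pair_preimage mZ (mX n) mD.
  transitivity (\int[P]_w (\1_[set w | D (killed_walk n w, X n w)] w)%:E)%E; first by [].
  by rewrite integral_indic// setIT.
have GE : (\int[P]_w G (killed_walk n w, X n w) =
    gap n + ((b n.+1 - b n)%:E * survival n + C%:E * P [set w | D3 (killed_walk n w, X n w)]))%E.
  rewrite /G ge0_integralD//; last 3 first.
  - exact: mcomp.
  - by move=> w _; rewrite adde_ge0.
  - by apply: emeasurable_funD; exact: mcomp.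
  congr (_ + _)%E; rewrite ge0_integralD//; try exact: mcomp.
  have mind D : measurable D ->
      measurable_fun setT (fun w => (\1_D (killed_walk n w, X n w))%:E : \bar R).
    by move=> mD; apply/measurable_EFinP; apply: measurableT_comp mZX; exact: measurable_indic.
  rewrite /G2 /G3 (ge0_integralZl P measurableT (mind _ mD2))//; last by rewrite lee_fin subr_ge0.
  by rewrite (ge0_integralZl P measurableT (mind _ mD3))// !int_ind.
have FG : (gap n.+1 <= \int[P]_w G (killed_walk n w, X n w))%E.
  rewrite /gap/= (integral_indep2 (mX n) mZ YX (f := F))//.
  rewrite (integral_indep2 (mX n) mZ YX (f := G))//; last by move=> z; rewrite !adde_ge0.
  apply: le_integral_of_ge0 => [y _|y _]; first exact: integral_ge0.
  set muX := distribution P _.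
  have [yb|by_] := leP y (b n); last first.
    rewrite (eq_integral (cst 0%E)).
      by rewrite integral0 integral_ge0// => x _; rewrite !adde_ge0.
    move=> x _; rewrite /F /kill_step/= leNgt by_/=.
    by rewrite max_r// opprD addrA subrr sub0r lerN10.
  have b'y : 0 <= b n.+1 - y by rewrite subr_ge0 (le_trans yb).
  have mI : measurable (X n @^-1` `]b n.+1 - y, +oo[) by exact: measurable_preimage.
  rewrite (eq_integral (fun x : R => (Num.max (b n.+1 - y - x) 0)%:E)); last first.
    move=> x _; rewrite /F /kill_step/= yb/=; case: ifPn => [_|].
      by rewrite opprD addrA.
    rewrite -ltNge => xb; congr EFin; rewrite !max_r//; lra.
  apply: le_trans (overshoot _ b'y) _.
  have GyE x : G (y, x) = ((b n.+1 - y)%:E + C%:E * (\1_(`]b n.+1 - y, +oo[%classic : set R) x)%:E)%E.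
    rewrite /G /G1 /G2 /G3 !indicE/= max_l ?subr_ge0// mem_set//= mule1 addeA -EFinD.
    rewrite -EFinM -[RHS]EFinD; congr EFin; congr (_ + _ * _); first by ring.
    suff -> : ((y, x) \in D3) = (x \in (`]b n.+1 - y, +oo[%classic : set R)) by [].
    by apply/idP/idP; rewrite !inE /D3/= in_itv/= andbT yb/= ltrBlDl.
  under eq_integral do rewrite GyE.
  have mI' : measurable_fun setT (fun x : R => (\1_(`]b n.+1 - y, +oo[%classic : set R) x)%:E : \bar R).
    by apply/measurable_EFinP; exact: measurable_indic.
  rewrite ge0_integralD//; try by [move=> x _; rewrite mule_ge0// lee_fin|exact: measurable_funeM].
  rewrite integral_cst// [X in (_ * X + _)%E]probability_setT mule1 leeD2l// ge0_integralZl//.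
  by rewrite integral_indic// setIT.
(* A walk alive at time n is either killed at the next step or survives it. The killing cost thus
   becomes a difference of survival probabilities, which telescopes. *)
have DE : (P [set w | D3 (killed_walk n w, X n w)] + survival n.+1 = survival n)%E.
  rewrite /survival -measureU.
  - congr (P _); apply/seteqP; split => w /=; rewrite kill_step_le// /D3/=.
      by case=> /andP[].
    by move=> Zb; rewrite Zb /=; case: leP => _; [right|left].
  - exact: (measurable_pair_preimage mZ (mX n) mD3).
  - by apply: measurable_le_preimage; exact: (measurable_killed_walk n.+1).
  - apply/seteqP; split => // w [] /=; rewrite kill_step_le// /D3/= => /andP[_ ?] /andP[_].
    by rewrite leNgt => /negP.
rewrite -[X in (_ + C%:E * X + _)%E]DE ge0_muleDr//.
move: FG; rewrite GE => FG.
by rewrite (le_trans (leeD2r _ FG))// -[leRHS]addeA [X in (_ <= _ + X)%E]addeC !addeA.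
Qed.

(** Markov's inequality: the barrier is nonnegative, so a killed walk below -s has gap at least s,
    and by domination this has at least the probability of survival times that of the free walk
    being below -s. *)
Lemma gap_ge n (s : R) : 0 <= s ->
  (s%:E * (survival n * P [set w | (partial_sum n w <= - s)%R]) <= gap n)%E.
Proof.
move=> s0; have mZ := measurable_killed_walk n.
have mE : measurable [set w | killed_walk n w <= - s] by exact: measurable_le_preimage.
apply: (@le_trans _ _ (s%:E * P [set w | (killed_walk n w <= - s)%R])%E).
  rewrite lee_wpmul2l ?lee_fin//; have := killed_walk_dominated n (- s).
  by rewrite min_l// (le_trans _ (barrier_ge0 n))// oppr_le0.
rewrite -(setIT [set w | _]) -integral_indic// -ge0_integralZl//; last first.
  by apply/measurable_EFinP; exact: measurable_indic.
apply: ge0_le_integral => //.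
- by move=> w _; rewrite mule_ge0// lee_fin.
- by apply: measurable_funeM; apply/measurable_EFinP; exact: measurable_indic.
- by apply/measurable_EFinP; apply: measurable_maxr => //; exact: measurable_funB.
- move=> w _; rewrite indicE; case: (boolP (w \in _)) => [|_].
    rewrite inE/= => Zs; rewrite mule1 lee_fin le_max; apply/orP; left.
    by have := barrier_ge0 n; lra.
  by rewrite mule0 lee_fin le_max lexx orbT.
Qed.

(** Taking s = sigma sqrt n in [gap_ge] bounds survival by the gap over p0 sigma sqrt n. Inserted in
    [gapS], this multiplies gap plus C sigma survival by at most 1 + (b n.+1 - b n)/(p0 sigma sqrt
    n) per step, and 1 + x <= exp x gives a discrete Gronwall bound. *)
Lemma survival_le (C sigma p0 : R) : 0 <= C -> 0 < sigma -> 0 < p0 ->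
  (forall n (u : R), 0 <= u ->
     (\int[distribution P (mfun_of (mX n))]_x (Num.max (u - x) 0)%:E <=
      u%:E + (C * sigma)%:E * P (X n @^-1` `]u, +oo[))%E) ->
  (forall n, (0 < n)%N ->
     (p0%:E <= P [set w | (partial_sum n w <= - (sigma * Num.sqrt n%:R))%R])%E) ->
  forall n, (0 < n)%N -> (survival n <=
    ((C * sigma + b 1) *
     expR (\sum_(1 <= i < n) (b i.+1 - b i) / (p0 * sigma * Num.sqrt i%:R)) /
     (p0 * sigma * Num.sqrt n%:R))%:E)%E.
Proof.
move=> C0 sigma0 p00 overshoot low.
have Cs0 : 0 <= C * sigma by rewrite mulr_ge0// ltW.
have surv_fin n : survival n \is a fin_num.
  by apply: fin_num_measure; apply: measurable_le_preimage; exact: measurable_killed_walk.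
have surv_ge0 n : (0 <= survival n)%E by exact: measure_ge0.
have surv_gap n (K : R) : (0 < n)%N -> (gap n <= K%:E)%E ->
    (survival n <= (K / (p0 * sigma * Num.sqrt n%:R))%:E)%E.
  move=> n0 gK; have sn0 : 0 < sigma * Num.sqrt n%:R by rewrite mulr_gt0// sqrtr_gt0 ltr0n.
  have : ((sigma * Num.sqrt n%:R)%:E * (survival n * p0%:E) <= K%:E)%E.
    apply: le_trans gK; apply: le_trans (gap_ge n (ltW sn0)).
    apply: lee_wpmul2l; first by rewrite lee_fin ltW.
    by apply: lee_wpmul2l => //; exact: low.
  rewrite -(fineK (surv_fin n)) -!EFinM !lee_fin => H.
  rewrite ler_pdivlMr; last by rewrite -mulrA mulr_gt0.
  by move: H; lra.
pose S n := \sum_(1 <= i < n) (b i.+1 - b i) / (p0 * sigma * Num.sqrt i%:R).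
have main n : (0 < n)%N ->
    (gap n + (C * sigma)%:E * survival n <= ((C * sigma + b 1) * expR (S n))%:E)%E.
  case: n => // n _; elim: n => [|n ih].
    (* The Gronwall recursion divides by sqrt n, so it starts at 1. The step from 0 is made by hand:
       gap b 0 and survival 1 add up to C sigma + b 1. *)
    rewrite /S big_geq// expR0 mulr1.
    apply: le_trans (gapS (overshoot 0%N) Cs0) _.
    have s0 : survival 0 = 1%E.
      rewrite /survival/= (_ : [set _ | _] = setT) ?probability_setT//.
      by apply/seteqP; split => // w _ /=; rewrite b0.
    have -> : gap 0 = (b 0%N)%:E.
      rewrite /gap/= subr0 max_l//.
      have -> : (\int[P]_(x in setT) cst (b 0%N)%:E x = (b 0%N)%:E * P setT)%E := integral_cst P measurableT (b 0%N)%:E.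
      by rewrite [X in (_ * X)%E]probability_setT mule1.
    by rewrite s0 !mule1 -!EFinD lee_fin; lra.
  apply: le_trans (gapS (overshoot n.+1) Cs0) _.
  set K := (_ * expR (S n.+1)) in ih.
  have K0 : 0 <= K by rewrite mulr_ge0 ?expR_ge0// addr_ge0// barrier_ge0.
  have := surv_gap n.+1 K isT; rewrite (le_trans _ ih); last first.
    by rewrite leeDl// mule_ge0.
  move=> /(_ erefl) sK.
  have bb0 : 0 <= b n.+2 - b n.+1 by rewrite subr_ge0.
  apply: (@le_trans _ _ (K%:E + (b n.+2 - b n.+1)%:E * (K / (p0 * sigma * Num.sqrt n.+1%:R))%:E)%E).
    by apply: leeD => //; rewrite lee_wpmul2l ?lee_fin.
  rewrite -EFinM -EFinD lee_fin /S big_nat_recr//= -/(S n.+1) expRD mulrA -/K.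
  rewrite mulrCA -[X in X + _]mulr1 -mulrDr ler_wpM2l//.
  by rewrite (le_trans _ (expR_ge1Dx _)).
move=> n n0; apply: surv_gap => //; apply: le_trans (main n n0).
by rewrite leeDl// mule_ge0.
Qed.
End KilledWalk.

(** * Barriers growing like a power below 1/2 *)

Section PowerBarrier.
Variable R : realType.
Implicit Types (gamma rho B : R).

(** Since gamma <= 1, (1 + 1/n)^gamma is at most 1 + 1/n. *)
Lemma powR_succ_sub_le gamma (n : nat) : 0 <= gamma <= 1 -> (0 < n)%N ->
  n.+1%:R `^ gamma - n%:R `^ gamma <= n%:R `^ (gamma - 1) :> R.
Proof.
move=> /andP[g0 g1] n0; have n0' : (0 : R) < n%:R by rewrite ltr0n.
have -> : n.+1%:R = n%:R * (1 + n%:R^-1) :> R.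
  by rewrite mulrDr mulr1 divff ?gt_eqF// natr1.
have n1 : 1 <= 1 + n%:R^-1 :> R by rewrite lerDl invr_ge0 ltW.
rewrite powRM ?(ltW n0')//.
rewrite lerBlDr (le_trans (ler_wpM2l (powR_ge0 _ _) (_ : _ <= 1 + n%:R^-1)))//.
  by rewrite -{2}[1 + _]powRr1 ?ler_powR// (le_trans ler01).
rewrite mulrDr mulr1 addrC lerD2r powRB ?(gt_eqF n0') ?implybT//.
by rewrite (powRr1 (ltW n0')).
Qed.

(** A telescoping form of the integral test, where ln(1 - 1/x) <= -1/x and 1 + y <= exp y replace
    the mean value theorem. *)
Lemma sum_powR_le rho (n : nat) : 0 < rho ->
  \sum_(1 <= i < n) i%:R `^ (- (1 + rho)) <= 1 + rho^-1 :> R.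
Proof.
move=> rho0.
have step (i : nat) : (0 < i)%N ->
    rho * i.+1%:R `^ (- (1 + rho)) <= i%:R `^ (- rho) - i.+1%:R `^ (- rho) :> R.
  move=> i0; have i0' : (0 : R) < i%:R by rewrite ltr0n.
  set x : R := i.+1%:R; have x0 : 0 < x by rewrite ltr0n.
  have lnx : ln i%:R <= ln x - x^-1.
    have x1 : x^-1 < 1 by rewrite invf_lt1// ltr1n ltnS.
    have -> : i%:R = x * (1 - x^-1) :> R.
      by rewrite mulrBr mulr1 divff ?gt_eqF// /x -natr1 addrK.
    rewrite lnM ?posrE ?subr_gt0// lerD2l le_ln1Dx//.
    by rewrite ltrN2.
  have -> : x `^ (- (1 + rho)) = x `^ (- rho) * x^-1.
    rewrite (_ : - (1 + rho) = - rho + -1); last by ring.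
    by rewrite powRD ?(gt_eqF x0) ?implybT// (powR_inv1 (ltW x0)).
  have : x `^ (- rho) * (1 + rho * x^-1) <= i%:R `^ (- rho).
    rewrite /powR !gt_eqF// (@le_trans _ _ (expR (- rho * ln x) * expR (rho * x^-1)))//.
      by rewrite ler_wpM2l ?expR_ge0// expR_ge1Dx.
    rewrite -expRD ler_expR; have := ler_wpM2l (ltW rho0) lnx; rewrite mulrBr !mulNr => H.
    by rewrite -lerBrDr -opprD lerN2 -lerBrDr.
  by rewrite mulrDr mulr1 lerBrDl mulrCA.
have main (m : nat) : \sum_(1 <= i < m.+2) i%:R `^ (- (1 + rho)) <= 1 + rho^-1 * (1 - m.+1%:R `^ (- rho)) :> R.
  elim: m => [|m ih].
    by rewrite big_nat1 !powR1 subrr mulr0 addr0.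
  rewrite big_nat_recr//=; have := step m.+1 isT; rewrite -ler_pdivlMl// => H.
  by rewrite (le_trans (lerD ih H))//; lra.
have r0 : 0 <= 1 + rho^-1 by rewrite addr_ge0// invr_ge0 ltW.
case: n => [|[|n]]; [by rewrite big_geq|by rewrite big_geq|].
apply: le_trans (main n) _; rewrite lerD2l.
rewrite -[leRHS]mulr1; apply: ler_wpM2l; first by rewrite invr_ge0 ltW.
by rewrite gerBl powR_ge0.
Qed.

(** Here gamma < 1/2 enters: i^(gamma-1) / sqrt i = i^(-(1+rho)) with rho = 1/2 - gamma > 0, so the
    Gronwall exponent is bounded. The barrier is scaled by [sigma], which therefore cancels, and [M]
    can be chosen before the space and the step size. *)
Lemma walk_survival_le gamma B (C p0 : R) : 0 < gamma < 1 / 2 -> 0 <= B -> 0 <= C -> 0 < p0 ->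
  exists M : R, forall d (Omega : measurableType d) (P : probability Omega R)
    (X : nat -> Omega -> R) (mX : forall n, measurable_fun setT (X n)) (sigma : R),
  (forall n (A : nat -> set R), (forall i, measurable (A i)) ->
    P (\bigcap_(i < n) X i @^-1` A i) = (\prod_(i < n) P (X i @^-1` A i))%E) ->
  0 < sigma ->
  (forall n (u : R), 0 <= u ->
     (\int[distribution P (mfun_of (mX n))]_x (Num.max (u - x) 0)%:E <=
      u%:E + (C * sigma)%:E * P (X n @^-1` `]u, +oo[))%E) ->
  (forall n, (0 < n)%N ->
     (p0%:E <= P [set w | (partial_sum X n w <= - (sigma * Num.sqrt n%:R))%R])%E) ->
  forall n, (0 < n)%N ->
  (P [set w | forall i, (i <= n)%N -> (partial_sum X i w <= sigma * (B * i%:R `^ gamma))%R] <=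
   (M / Num.sqrt n%:R)%:E)%E.
Proof.
move=> /andP[g0 g12] B0 C0 p00.
pose rho := 2^-1 - gamma.
have rho0 : 0 < rho by rewrite /rho; lra.
exists ((C + B) * expR (B / p0 * (1 + rho^-1)) / p0) => d Omega P X mX sigma Xi s0 over low n n0.
pose b (i : nat) := sigma * (B * i%:R `^ gamma).
have b0 : 0 <= b 0%N by rewrite /b !mulr_ge0 ?powR_ge0// ltW.
have bnd i : b i <= b i.+1.
  rewrite /b ler_wpM2l//; first exact: ltW.
  by rewrite ler_wpM2l// ge0_ler_powR ?nnegrE ?ler0n ?ler_nat// ltW.
have := survival_le Xi b0 bnd C0 s0 p00 over low n0.
rewrite /survival (_ : [set w | killed_walk X b n w <= b n] =
  [set w | forall i, (i <= n)%N -> partial_sum X i w <= b i]); last first.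
  by apply/seteqP; split => w; have [wb bw] := killed_walk_leP X b0 n w.
move=> /le_trans; apply; rewrite lee_fin.
have sn0 : 0 < Num.sqrt n%:R :> R by rewrite sqrtr_gt0 ltr0n.
rewrite [leRHS](_ : _ = (C * sigma + b 1%N) * expR (B / p0 * (1 + rho^-1)) / (p0 * sigma * Num.sqrt n%:R)); last first.
  by rewrite /b powR1; field; rewrite !gt_eqF.
rewrite ler_wpM2r//; first by rewrite invr_ge0 !mulr_ge0// ltW.
apply: ler_wpM2l.
  by rewrite /b addr_ge0 ?mulr_ge0 ?powR_ge0// (ltW s0).
rewrite ler_expR; apply: (@le_trans _ _ (B / p0 * \sum_(1 <= i < n) i%:R `^ (- (1 + rho)))); last first.
  by rewrite ler_wpM2l ?sum_powR_le// divr_ge0// ltW.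
rewrite mulr_sumr !big_nat; apply: ler_sum => i /andP[i0 _].
have i0' : (0 : R) < i%:R by rewrite ltr0n.
have -> : i%:R `^ (- (1 + rho)) = i%:R `^ (gamma - 1) / Num.sqrt i%:R :> R.
  rewrite -powR12_sqrt ?ltW// -powRB ?(gt_eqF i0') ?implybT//; congr (_ `^ _).
  by rewrite /rho; field.
rewrite /b -mulrBr -mulrBr.
have g01 : 0 <= gamma <= 1 by rewrite (ltW g0)/=; lra.
have := powR_succ_sub_le g01 i0; set D := _ - _; set G := _ `^ (gamma - 1) => DG.
have si0 : 0 < Num.sqrt i%:R :> R by rewrite sqrtr_gt0.
rewrite [leLHS](_ : _ = B / p0 * (D / Num.sqrt i%:R)); last by field; rewrite !gt_eqF.
rewrite ler_wpM2l//; first by rewrite divr_ge0// ltW.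
by rewrite ler_wpM2r// invr_ge0 ltW.
Qed.
End PowerBarrier.

(** * Regular variation *)

Lemma near_right0 (R : realType) (P : R -> Prop) :
  (\forall u \near (0:R)^'+, P u) -> exists2 d : R, 0 < d & forall u : R, 0 < u < d -> P u.
Proof.
move=> [d /= d0 H]; exists d => // u /andP[u0 ud]; apply: H => //=.
by rewrite sub0r normrN gtr0_norm.
Qed.

Section InverseIntegral.
Variable R : realType.
Implicit Types a b : R.
Local Notation mu := (@lebesgue_measure R).

Lemma within_continuous_inv a b : 0 < a ->
  {within `[a, b], continuous (fun x : R => x^-1)}.
Proof.
move=> a0; apply/continuous_in_subspaceT => x /[1!inE]/=.
by rewrite in_itv/= => /andP[ax _]; apply: inv_continuous; rewrite gt_eqF// (lt_le_trans a0).
Qed.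

Lemma integrable_inv_oc a b : 0 < a -> mu.-integrable `]a, b] (EFin \o (fun x : R => x^-1)).
Proof.
move=> a0; apply: (@integrableS _ _ _ mu `[a, b]) => //; first exact: subset_itv_oc_cc.
apply: continuous_compact_integrable; first exact: segment_compact.
exact: within_continuous_inv.
Qed.

Lemma integral_inv_cc a b : 0 < a < b ->
  (\int[mu]_(x in `[a, b]) (x^-1)%:E = (ln b - ln a)%:E)%E.
Proof.
move=> /andP[a0 ab]; have b0 := lt_trans a0 ab.
rewrite EFinB; apply: continuous_FTC2 => //; first exact: within_continuous_inv.
  split.
  - move=> x; rewrite in_itv/= => /andP[ax _].
    by apply: ex_derive; apply: is_derive1_ln; exact: lt_trans ax.
  - by apply: cvg_at_right_filter; exact: continuous_ln.
  - by apply: cvg_at_left_filter; exact: continuous_ln.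
move=> x; rewrite in_itv/= => /andP[ax _].
rewrite derive1E; have := is_derive1_ln (lt_trans a0 ax).
by move=> dx; rewrite derive_val.
Qed.

Lemma Rintegral_inv_oc a b : 0 < a -> a <= b ->
  \int[mu]_(x in `]a, b]) x^-1 = ln b - ln a.
Proof.
move=> a0; rewrite le_eqVlt => /predU1P[->|ab].
  by rewrite subrr set_itv_ge ?bnd_simp//= Rintegral_set0.
rewrite Rintegral_itv_obnd_cbnd; last exact: integrable_inv_oc.
by rewrite /Rintegral integral_inv_cc ?a0.
Qed.

End InverseIntegral.

(** * Comparison of theta at two points near zero *)

Section Karamata.
Variables (R : realType) (theta c eps : R -> R).
Hypothesis thetaE : karamata_representation theta c eps.
Local Notation mu := (@lebesgue_measure R).

Let E (u : R) := \int[mu]_(v in `]u, 1[) (eps v / v).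

Let integrable_eps u : 0 < u -> mu.-integrable `]u, 1[ (EFin \o (fun v => eps v / v)).
Proof.
move=> u0; have [c0 [_ c01]] := karamata_eps_bounded thetaE.
have su : `]u, 1[ `<=` (`]0, 1[ : set R) by apply: subset_itvr; rewrite bnd_simp ltW.
apply: measurable_bounded_integrable => //.
- by rewrite [X in (X < _)%E]lebesgue_measure_itv/=; case: ifP => _; rewrite ?ltry// -EFinB ltry.
- apply: measurable_funM.
    by apply: measurable_funS (karamata_eps_meas thetaE).
  apply: (@measurable_funS _ _ _ _ `[u, 1]) => //; first exact: subset_itv_oo_cc.
  by apply: subspace_continuous_measurable_fun => //; exact: within_continuous_inv.
have M0 : 0 < `|c0| + 1 by rewrite ltr_wpDl.
exists ((`|c0| + 1) / u); split; first exact: num_real.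
move=> M MM v /= vu.
move: (vu); rewrite in_itv/= => /andP[uv v1]; have v0 := lt_trans u0 uv.
have cM : `|eps v| <= `|c0| + 1.
  by apply: c01; [rewrite (le_lt_trans (ler_norm _)) ?ltrDl|exact: su].
rewrite (le_trans _ (ltW MM))// normrM (gtr0_norm (_ : 0 < v^-1)) ?invr_gt0//.
by rewrite ler_pM// ?invr_ge0 ?(ltW v0)// lef_pV2 ?posrE// ltW.
Qed.

Let E_sub a b : 0 < a -> a <= b -> b < 1 ->
  E a - E b = \int[mu]_(v in `]a, b]) (eps v / v).
Proof.
move=> a0 ab b1; have := Rintegral_itvB (integrable_eps a0).
move=> /(_ b); rewrite !bnd_simp ab b1 /E => /(_ erefl erefl) <-.
by rewrite opprB addrCA subrr addr0.
Qed.

Let integrable_eps_oc a b : 0 < a -> b < 1 ->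
  mu.-integrable `]a, b] (EFin \o (fun v => eps v / v)).
Proof.
move=> a0 b1; apply: (integrableS _ _ _ (integrable_eps a0)) => //.
by apply: subset_itvl; rewrite bnd_simp.
Qed.

Let integrable_cst_inv (m a b : R) : 0 < a ->
  mu.-integrable `]a, b] (EFin \o (fun v : R => m * v^-1)).
Proof.
move=> a0.
have mD : measurable (`]a, b] : set (measurableTypeR R)) := measurable_itv _.
have := integrableZl mD m (integrable_inv_oc b a0).
by apply: eq_integrable => // x _ /=; rewrite EFinM.
Qed.

Let E_le (m a b : R) : 0 < a -> a <= b -> b < 1 ->
  (forall x, a < x <= b -> eps x <= m) -> E a - E b <= m * (ln b - ln a).
Proof.
move=> a0 ab b1 em; rewrite E_sub// -(Rintegral_inv_oc a0 ab).
rewrite -RintegralZl//; last exact: integrable_inv_oc.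
apply: le_Rintegral => //; first exact: integrable_eps_oc.
  exact: integrable_cst_inv.
move=> x /=; rewrite in_itv/= => /andP[ax xb].
by rewrite ler_wpM2r ?em ?ax// invr_ge0 (ltW (lt_trans a0 ax)).
Qed.

Let E_ge (m a b : R) : 0 < a -> a <= b -> b < 1 ->
  (forall x, a < x <= b -> m <= eps x) -> m * (ln b - ln a) <= E a - E b.
Proof.
move=> a0 ab b1 em; rewrite E_sub// -(Rintegral_inv_oc a0 ab).
rewrite -RintegralZl//; last exact: integrable_inv_oc.
apply: le_Rintegral => //; first exact: integrable_cst_inv.
  exact: integrable_eps_oc.
move=> x /=; rewrite in_itv/= => /andP[ax xb].
by rewrite ler_wpM2r ?em ?ax// invr_ge0 (ltW (lt_trans a0 ax)).
Qed.

(** The limit of [c] is nonzero and [c] is positive, so the limit c0 is positive; near zero c lies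
    between c0/2 and 2 c0, whence the factor 4. *)
Let c_ratio : exists2 d : R, 0 < d < 1 &
  forall u v : R, 0 < u < d -> 0 < v < d -> c u <= 4 * c v.
Proof.
have [c0 c00 cc0] := karamata_c_lim thetaE.
have [d' d'0 c_gt0] : exists2 d : R, 0 < d & forall u : R, 0 < u < d -> 0 < c u.
  by exists 1 => // u; exact: (karamata_c_pos thetaE).
have c0_gt0 : 0 < c0.
  rewrite lt_neqAle eq_sym c00 leNgt; apply/negP => c0lt0.
  have /near_right0[e e0 ec] : \forall u \near (0:R)^'+, c u < 0.
    exact: (cvgr_lt c0).
  have m0 : 0 < Num.min e d' by rewrite lt_min e0.
  have mm : Num.min e d' / 2 < Num.min e d' by rewrite ltr_pdivrMr// ltr_pMr// ltr1n.
  have [me md] : Num.min e d' / 2 < e /\ Num.min e d' / 2 < d'.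
    by split; apply: lt_le_trans mm _; rewrite ge_min lexx ?orbT.
  have := ec (Num.min e d' / 2); rewrite divr_gt0//= me => /(_ erefl) H.
  by have := c_gt0 (Num.min e d' / 2); rewrite divr_gt0//= md => /(_ erefl); lra.
have /near_right0[e e0 ec] : \forall u \near (0:R)^'+, c0 / 2 < c u < 2 * c0.
  near=> u; apply/andP; split; near: u.
    by apply: (cvgr_gt c0) => //; lra.
  by apply: (cvgr_lt c0) => //; lra.
have m0 : 0 < Num.min e 1 by rewrite lt_min e0/=.
exists (Num.min e (1/2)); first by rewrite lt_min e0 gt_min/=; apply/andP; split; [lra|apply/orP; right; lra].
move=> u v /andP[u0]; rewrite lt_min => /andP[ue _] /andP[v0]; rewrite lt_min => /andP[ve _].
have := ec u; rewrite u0 ue => /(_ erefl)/andP[_ cu].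
have := ec v; rewrite v0 ve => /(_ erefl)/andP[cv _].
by lra.
Unshelve. all: by end_near. Qed.

Let eps_near0 (eta : R) : 0 < eta -> exists2 d : R, 0 < d &
  forall x, 0 < x < d -> - eta <= eps x <= eta.
Proof.
move=> eta0; have := karamata_eps_lim thetaE.
move=> /cvgrPdist_le/(_ _ eta0)/near_right0[d d0 H]; exists d => // x /H.
by rewrite sub0r normrN ler_norml.
Qed.

Let theta_le (M u v : R) : 0 < u < 1 -> 0 < v < 1 -> c u <= 4 * c v ->
  E u - E v <= M -> theta u <= 4 * expR M * theta v.
Proof.
move=> u01 v01 cuv EM; rewrite !(karamata_eq thetaE)// -/(E u) -/(E v).
have cu := karamata_c_pos thetaE u01; have cv := karamata_c_pos thetaE v01.
rewrite (_ : 4 * _ * _ = 4 * c v * (expR M * expR (E v))); last by ring.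
rewrite ler_pM ?expR_ge0// ?(ltW cu)// -expRD ler_expR; lra.
Qed.

Lemma karamata_gt0 u : 0 < u < 1 -> 0 < theta u.
Proof.
by move=> u01; rewrite (karamata_eq thetaE)// mulr_gt0 ?expR_gt0// (karamata_c_pos thetaE).
Qed.

(** Potter's bounds: where |eps| <= eta, the exponents at u and v differ by at most eta ln(v/u). *)
Lemma karamata_potter (eta : R) : 0 < eta -> exists2 d : R, 0 < d < 1 &
  forall u v : R, 0 < u -> u <= v -> v < d ->
    theta u <= 4 * (v / u) `^ eta * theta v /\ theta v <= 4 * (v / u) `^ eta * theta u.
Proof.
move=> eta0; have [d1 /andP[d10 d11] cd] := c_ratio; have [d2 d20 ed] := eps_near0 eta0.
exists (Num.min d1 d2); first by rewrite lt_min d10 d20 gt_min d11.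
move=> u v u0 uv; rewrite lt_min => /andP[vd1 vd2].
have v0 := lt_le_trans u0 uv; have v1 := lt_trans vd1 d11; have u1 := le_lt_trans uv v1.
have u01 : 0 < u < 1 by rewrite u0.
have v01 : 0 < v < 1 by rewrite v0.
have ud1 := le_lt_trans uv vd1.
have -> : (v / u) `^ eta = expR (eta * (ln v - ln u)).
  by rewrite /powR gt_eqF ?divr_gt0// ln_div.
have e2 x : u < x <= v -> - eta <= eps x <= eta.
  by move=> /andP[ux xv]; apply: ed; rewrite (lt_trans u0 ux) (le_lt_trans xv).
split; apply: theta_le => //.
- by apply: cd; rewrite ?u0 ?v0.
- by apply: E_le => // x /e2/andP[].
- by apply: cd; rewrite ?u0 ?v0.
- have := E_ge u0 uv v1 (fun x xuv => proj1 (andP (e2 x xuv))); lra.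
Qed.

(** On ]u, v] the bound on [eps] is largest at v, so the exponents differ by at most ln(v/u) / |ln
    v|^alpha <= 1. Unlike in Potter's bounds, no power of v/u is lost. *)
Lemma karamata_slow (alpha : R) : 0 < alpha ->
  (\forall v \near (0:R)^'+, eps v < 1 / `|ln v| `^ alpha) ->
  exists2 d : R, 0 < d < 1 & forall u v : R, 0 < u -> u <= v -> v < d ->
    ln (v / u) <= `|ln v| `^ alpha -> theta u <= 4 * expR 1 * theta v.
Proof.
move=> a0 /near_right0[d2 d20 ed]; have [d1 /andP[d10 d11] cd] := c_ratio.
exists (Num.min d1 d2); first by rewrite lt_min d10 d20 gt_min d11.
move=> u v u0 uv; rewrite lt_min => /andP[vd1 vd2].
have v0 := lt_le_trans u0 uv; have v1 := lt_trans vd1 d11; have u1 := le_lt_trans uv v1.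
have ud1 := le_lt_trans uv vd1.
rewrite ln_div// => lnuv; apply: theta_le; rewrite ?u0 ?v0//.
  by apply: cd; rewrite ?u0 ?v0.
have lnv : ln v < 0 by rewrite ln_lt0 ?v0.
have la : 0 < `|ln v| `^ alpha by rewrite powR_gt0// normr_gt0 lt_eqF.
apply: (@le_trans _ _ (1 / `|ln v| `^ alpha * (ln v - ln u))).
  apply: E_le => // x /andP[ux xv]; have x0 := lt_trans u0 ux.
  apply/ltW/(lt_le_trans (ed x _)); first by rewrite x0 (le_lt_trans xv).
  rewrite !div1r lef_pV2 ?posrE//; last first.
    by rewrite powR_gt0// normr_gt0 lt_eqF// ln_lt0// x0 (le_lt_trans xv).
  rewrite ge0_ler_powR ?nnegrE ?(ltW a0)//.
  have lnx : ln x <= ln v by rewrite ler_ln.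
  by rewrite !ltr0_norm ?lerN2// (le_lt_trans lnx).
by rewrite mul1r mulrC ler_pdivrMr// mul1r.
Qed.

End Karamata.

(** * Monotonicity of psi on the half-line *)

Section PsiMonotone.
Variables (R : realType) (psi theta c eps : R -> R) (kappa : R).
Hypothesis psi_ge0 : forall u, 0 <= psi u.
Hypothesis psi_convex : forall x y t : R, 0 <= t <= 1 ->
  psi (t * x + (1 - t) * y) <= t * psi x + (1 - t) * psi y.
Hypothesis kappa1 : 1 <= kappa.
Hypothesis psiE : forall u : R, 0 < u -> psi u = u `^ kappa * theta u.
Hypothesis thetaE : karamata_representation theta c eps.

Lemma psi_gt0_near0 u : 0 < u < 1 -> 0 < psi u.
Proof.
move=> /andP[u0 u1]; rewrite psiE// mulr_gt0 ?powR_gt0// (karamata_gt0 thetaE)//.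
by rewrite u0.
Qed.

(** [psiE] only concerns positive arguments; the value at 0 follows from convexity between -1 and a
    small u > 0, which gives psi 0 <= psi u + u psi(-1), while Potter's bound makes psi u small. *)
Lemma psi0 : psi 0 = 0.
Proof.
apply/eqP; rewrite eq_le psi_ge0 andbT; apply/ler_addgt0Pl => e e0; rewrite addr0.
have h0 : (0 : R) < 2^-1 by rewrite invr_gt0.
have [d /andP[d0 d1] H] := karamata_potter thetaE h0.
pose b := d / 2; have b0 : 0 < b by rewrite divr_gt0.
have bd : b < d by rewrite /b; lra.
have b1 : b < 1 by rewrite (lt_trans bd).
clearbody b.
have tb : 0 < theta b by rewrite (karamata_gt0 thetaE)// b0.
pose K := 4 * theta b + psi (- 1).
have K0 : 0 < K by rewrite ltr_wpDr ?psi_ge0// mulr_gt0.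
(* With exponent 1/2 Potter's bound gives psi u of order sqrt u, hence the square: both psi u and u
   are at most a constant times m = sqrt u, and m K < e. *)
pose u := Num.min b (e / (K + 1)) ^+ 2.
have K1 : 0 < K + 1 by lra.
have eK : 0 < e / (K + 1) by rewrite divr_gt0.
set m := Num.min b (e / (K + 1)) in u *.
have m0 : 0 < m by rewrite lt_min b0.
have mb : m <= b by rewrite /m ge_min lexx.
have me : m <= e / (K + 1) by rewrite /m ge_min lexx orbT.
have u0 : 0 < u by rewrite exprn_gt0.
have um : u <= m by rewrite /u expr2 ler_piMr ?(ltW m0)//; lra.
have ub : u <= b by lra.
have tu : theta u <= 4 * m^-1 * theta b.
  have [tu _] := H u b u0 ub bd; apply: (le_trans tu).
  have sq : (b / u) `^ 2^-1 <= m^-1.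
    rewrite powR12_sqrt ?divr_ge0 ?(ltW u0) ?(ltW b0)//.
    rewrite sqrtrM ?(ltW b0)// sqrtrV ?(ltW u0)// /u sqrtr_sqr (gtr0_norm m0).
    rewrite ler_piMl ?invr_ge0 ?(ltW m0)//.
    by rewrite -[leRHS]sqrtr1 ler_wsqrtr// ltW.
  by rewrite (ler_wpM2r (ltW tb))// ler_wpM2l.
have psiu : psi u <= m * (4 * theta b).
  rewrite psiE//; apply: (@le_trans _ _ (u * theta u)).
    rewrite ler_wpM2r//; first by rewrite ltW// (karamata_gt0 thetaE)// u0 (le_lt_trans ub).
    have lnu : ln u <= 0 by rewrite ln_le0//; lra.
    rewrite /powR gt_eqF// -[leRHS]lnK ?posrE// ler_expR.
    by rewrite -[leRHS]mul1r ler_wnM2r.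
  apply: (@le_trans _ _ (u * (4 * m^-1 * theta b))).
    by rewrite ler_wpM2l// ltW.
  by rewrite /u le_eqVlt; apply/orP; left; apply/eqP; field; rewrite gt_eqF.
have cu := @psi_convex u (- 1) (1 + u)^-1.
have u1 : 0 < 1 + u by lra.
have {cu} : psi 0 <= psi u + u * psi (-1).
  have t1 : (1 + u)^-1 <= 1 by rewrite invf_le1// lerDl ltW.
  have t0 : 0 <= (1 + u)^-1 by rewrite invr_ge0 ltW.
  have := cu; rewrite t0 t1 => /(_ erefl).
  rewrite (_ : _ + _ * - 1 = 0); last by field; rewrite gt_eqF.
  move=> /le_trans; apply; apply: lerD; first by rewrite ler_piMl ?psi_ge0.
  rewrite ler_wpM2r ?psi_ge0// (_ : 1 - _ = u * (1 + u)^-1); last by field; rewrite gt_eqF.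
  by rewrite ler_piMr// ltW.
move=> /le_trans; apply; apply: (@le_trans _ _ (m * K)).
  rewrite /K mulrDr lerD// ler_wpM2r ?psi_ge0//.
apply: (@le_trans _ _ (e / (K + 1) * K)); first by rewrite ler_wpM2r// ltW.
by rewrite mulrAC ler_pdivrMr// ler_wpM2l ?(ltW e0)//; lra.
Qed.

(** Since psi 0 = 0, convexity on [0, y] gives psi x <= (x/y) psi y. *)
Lemma psi_nondecreasing x y : 0 <= x -> x <= y -> psi x <= psi y.
Proof.
move=> x0; rewrite le_eqVlt => /predU1P[->//|xy].
have y0 : 0 < y by exact: le_lt_trans xy.
have t1 : x / y <= 1 by rewrite ler_pdivrMr// mul1r ltW.
have t0 : 0 <= x / y by rewrite divr_ge0// ltW.
have := @psi_convex y 0 (x / y); rewrite t0 t1 => /(_ erefl).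
rewrite psi0 !mulr0 !addr0 divfK ?gt_eqF// => /le_trans; apply.
by rewrite ler_piMl.
Qed.
End PsiMonotone.

Lemma near_pinfty_ln (R : realType) (Q : R -> Prop) :
  (\forall L \near +oo, Q L) -> \forall T \near +oo, Q (ln T).
Proof.
move=> [M [Mr MQ]]; exists (expR M); split; first exact: num_real.
move=> T MT; apply: MQ; rewrite -ltr_expR lnK// posrE.
exact: lt_trans (expR_gt0 M) MT.
Qed.

Lemma near_pinfty_ge (R : realType) (M : R) : \forall x \near +oo, M <= x.
Proof. by exists M; split; [exact: num_real|move=> x /ltW]. Qed.

Lemma affine_ln_le_powR (R : realType) (a b alpha : R) : 0 < alpha ->
  \forall L \near +oo, a + b * ln L <= (L / 4) `^ alpha.
Proof.
move=> alpha0.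
pose D : R := `|a + b * ln 4| + `|b|.
(* From [Y] on, 4 D <= alpha^2 y, so that D y <= (alpha y / 2)^2 <= exp(alpha y). *)
pose Y : R := 1 + 4 * D / alpha ^+ 2.
exists (4 * expR Y); split; first exact: num_real.
move=> L YL; have L0 : 0 < L by rewrite (lt_trans _ YL)// mulr_gt0// expR_gt0.
have L40 : 0 < L / 4 by rewrite divr_gt0.
pose y := ln (L / 4).
have D0 : 0 <= D by rewrite addr_ge0.
have Yy : Y <= y.
  by rewrite /y -ler_expR lnK// ler_pdivlMr// mulrC ltW.
have al2 : 0 < alpha ^+ 2 by rewrite exprn_gt0.
have Y1 : 1 <= Y by rewrite lerDl divr_ge0 ?mulr_ge0// ltW.
have y1 : 1 <= y by exact: le_trans Yy.
have -> : ln L = y + ln 4.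
  by rewrite /y ln_div ?posrE// subrK.
apply: (@le_trans _ _ (y * D)).
  apply: (@le_trans _ _ (`|a + b * ln 4| + `|b| * y)).
    rewrite (_ : a + _ = (a + b * ln 4) + b * y); last by ring.
    by rewrite lerD ?ler_norm// ler_wpM2r ?ler_norm//; lra.
  rewrite /D mulrDr (mulrC y `|b|) lerD2r ler_peMl//.
apply: (@le_trans _ _ ((alpha * y) ^+ 2 / 4)).
  rewrite ler_pdivlMr//.
  have H : 4 * D <= alpha ^+ 2 * y.
    by rewrite -ler_pdivrMl// mulrC; apply: le_trans Yy; rewrite /Y lerDr.
  rewrite (_ : y * D * 4 = y * (4 * D)); last by ring.
  by rewrite (_ : _ ^+ 2 = y * (alpha ^+ 2 * y)) ?ler_wpM2l//; [lra|ring].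
rewrite /powR gt_eqF// -/y.
have e1 : 1 + alpha * y / 2 <= expR (alpha * y / 2) by exact: expR_ge1Dx.
have ay : 0 < alpha * y by rewrite mulr_gt0// (lt_le_trans ltr01).
rewrite (_ : alpha * y = alpha * y / 2 + alpha * y / 2); last by field.
rewrite expRD (_ : _ ^+ 2 / 4 = (alpha * y / 2) * (alpha * y / 2)); last by field.
have : alpha * y / 2 <= expR (alpha * y / 2) by lra.
by move=> H; rewrite ler_pM// ltW// divr_gt0.
Qed.

Section PsiScaling.
Variables (R : realType) (psi theta c eps g : R -> R) (kappa gamma C xi : R).
Hypothesis kappa12 : 1 <= kappa < 2.
Hypothesis psiE : forall u : R, 0 < u -> psi u = u `^ kappa * theta u.
Hypothesis thetaE : karamata_representation theta c eps.
Hypothesis eps_small : exists alpha : R, 0 < alpha < 1 /\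
  \forall v \near (0:R)^'+, eps v < 1 / `|ln v| `^ alpha.
Hypothesis C0 : 0 < C.
Hypothesis g_ge : \forall T \near +oo, C * ln T `^ (- xi) <= g T.
Hypothesis g_le1 : \forall T \near +oo, g T <= 1.
Hypothesis gamma01 : 0 <= gamma <= 1.
Hypothesis gamma_kappa : 0 < 1 - kappa * (1 - gamma).

(** Write v for the argument of psi on the right. As f^(2-kappa) = g T, the factor u^kappa g T comes
    out of both sides, leaving K theta u <= A^kappa n^eta theta v with eta = 1 - kappa (1 - gamma) >
    0. The power n^eta is what pays for Potter's bound when v has dropped below u. *)
Lemma psi_scaling K : exists2 A : R, 1 <= A & \forall T \near +oo,
  forall n : nat, (0 < n)%N -> forall f u : R,
    f = g T `^ (2 - kappa)^-1 -> u = (Num.sqrt T)^-1 ->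
    K * psi u * g T <= n%:R * f ^+ 2 * psi (A * n%:R `^ (gamma - 1) * u / f).
Proof.
have /andP[kappa1 kappa2] := kappa12; have /andP[gamma0 gamma1] := gamma01.
have [alpha [/andP[alpha0 alpha1] small]] := eps_small.
pose eta : R := 1 - kappa * (1 - gamma).
have eta0 : 0 < eta by exact: gamma_kappa.
have [d1 /andP[d10 d11] slow] := karamata_slow thetaE alpha0 small.
have [d2 /andP[d20 d21] potter] := karamata_potter thetaE eta0.
have e1 : 1 <= expR 1 :> R by rewrite -expR0 ler_expR.
(* Large enough to absorb K together with the factor 4e of [karamata_slow] or the factor 4 of
   [karamata_potter]. *)
pose A : R := 4 * expR 1 * (`|K| + 1).
have K0 := normr_ge0 K.
have A4e : 4 * expR 1 <= A by rewrite ler_peMr//; lra.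
have A1 : 1 <= A by lra.
have A0 : 0 < A by lra.
have KA : K * (4 * expR 1) <= A.
  by rewrite mulrC ler_wpM2l//; have := ler_norm K; lra.
have KA4 : K * 4 <= A.
  rewrite (le_trans (ler_norm _))// normrM (ger0_norm (_ : 0 <= 4))//.
  by rewrite /A; nra.
clearbody A.
pose p := (2 - kappa)^-1.
have p0 : 0 < p by rewrite invr_gt0; lra.
exists A => //.
(* With g >= C L^(-xi), where L = ln T, this says that ln(A/f) <= (L/4)^alpha: the lower bound on g
   is used here. *)
have near_main := near_pinfty_ln (affine_ln_le_powR (ln A - p * ln C) (p * xi) alpha0).
have near_L4 := near_pinfty_ln (near_pinfty_ge (4 : R)).
have near_Ld1 := near_pinfty_ln (near_pinfty_ge (1 - 4 * ln d1)).
have near_Ld2 := near_pinfty_ln (near_pinfty_ge (1 - 4 * ln d2)).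
near=> T => n n0 f u fE uE.
have main : ln A - p * ln C + p * xi * ln (ln T) <= (ln T / 4) `^ alpha by near: T.
have L4 : 4 <= ln T by near: T.
have Ld1 : 1 - 4 * ln d1 <= ln T by near: T.
have Ld2 : 1 - 4 * ln d2 <= ln T by near: T.
have gT : C * ln T `^ (- xi) <= g T by near: T.
have gT1 : g T <= 1 by near: T.
have T0 : 0 < T by near: T; exact: nbhs_pinfty_gt.
move: L4 Ld1 Ld2 main gT; set L := ln T => L4 Ld1 Ld2 main gT.
have L0 : 0 < L by lra.
have CL0 : 0 < C * L `^ (- xi) by rewrite mulr_gt0 ?powR_gt0.
have g0 : 0 < g T by exact: lt_le_trans gT.
have f0 : 0 < f by rewrite fE powR_gt0.
have f1 : f <= 1.
  rewrite -ler_ln ?posrE// ln1 fE ln_powR.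
  by apply: mulr_ge0_le0; [exact: (ltW p0)|exact: ln_le0].
have fg : f `^ (2 - kappa) = g T.
  by rewrite fE -powRrM mulVf ?powRr1// ?ltW// gt_eqF//; lra.
have u0 : 0 < u by rewrite uE invr_gt0 sqrtr_gt0.
have lnu : ln u = - (L / 2).
  by rewrite uE lnV ?posrE ?sqrtr_gt0// -powR12_sqrt ?ltW// ln_powR mulrC.
clearbody L.
have n0' : (0 : R) < n%:R by rewrite ltr0n.
have n1' : (1 : R) <= n%:R by rewrite ler1n.
set w : R := n%:R `^ (gamma - 1).
have w0 : 0 < w by rewrite powR_gt0.
have w1 : w <= 1 by rewrite -(powRr0 n%:R) ler_powR//; lra.
have Vw : w^-1 <= n%:R.
  by rewrite /w -powRN -[leRHS](powRr1 (ltW n0')) ler_powR//; lra.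
have neta : n%:R * w `^ kappa = n%:R `^ eta.
  rewrite /w -powRrM (_ : eta = 1 + (gamma - 1) * kappa); last by rewrite /eta; ring.
  by rewrite powRD ?(gt_eqF n0') ?implybT// (powRr1 (ltW n0')).
clearbody eta.
have Af : ln (A / f) <= (L / 4) `^ alpha.
  have lnf : ln f = p * ln (g T) by rewrite fE ln_powR.
  have -> : ln (A / f) = ln A - p * ln (g T) by rewrite ln_div ?posrE// lnf.
  have : ln C - xi * ln L <= ln (g T).
    apply: (@le_trans _ _ (ln (C * L `^ (- xi)))); last by rewrite ler_ln ?posrE.
    by rewrite lnM ?posrE ?powR_gt0// ln_powR mulNr.
  move=> /(ler_wpM2l (ltW p0)); rewrite mulrBr mulrA => H.
  by apply: le_trans main; rewrite -addrA lerD2l -lerN2 opprD !opprK.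
set v := A * w * u / f.
have vE : v = A * w * u / f by [].
have v0 : 0 < v by rewrite vE divr_gt0// !mulr_gt0.
clearbody v w.
have lnvu : ln (v / u) <= ln (A / f).
  rewrite ler_ln ?posrE ?(divr_gt0 v0 u0) ?(divr_gt0 A0 f0)//.
  rewrite (_ : v / u = w * (A / f)); last first.
    by rewrite vE; field; rewrite !gt_eqF.
  by rewrite ler_piMl// ltW// divr_gt0.
have L4a : (L / 4) `^ alpha <= L / 4.
  have L41 : 1 <= L / 4 by rewrite ler_pdivlMr// mul1r.
  by rewrite -[leRHS](powRr1 (le_trans ler01 L41)) ler_powR// ltW.
(* From ln u = -L/2 and ln(v/u) <= L/4. Hence |ln v| >= L/4, so (L/4)^alpha is an admissible range
   for [karamata_slow] at v. *)
have lnv : ln v <= - (L / 4).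
  have : ln (v / u) = ln v - ln u by rewrite ln_div.
  by rewrite lnu; lra.
have vd d : 0 < d -> 1 - 4 * ln d <= L -> v < d.
  by move=> d0 Ld; rewrite -ltr_ln ?posrE//; lra.
have ud d : 0 < d -> 1 - 4 * ln d <= L -> u < d.
  by move=> d0 Ld; rewrite -ltr_ln ?posrE// lnu; lra.
have v1 : v < 1 by apply: lt_trans (vd _ d10 Ld1) d11.
have tv : 0 < theta v by rewrite (karamata_gt0 thetaE)// v0.
have net1 : 1 <= n%:R `^ eta :> R by rewrite -[leLHS](powRr0 n%:R) ler_powR// ltW.
have key : K * theta u <= A * n%:R `^ eta * theta v.
  have tu : 0 < theta u by rewrite (karamata_gt0 thetaE)// u0 (lt_trans (ud _ d10 Ld1)).
  have [K_le0|K_gt0] := leP K 0.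
    apply: (@le_trans _ _ 0); first by rewrite mulr_le0_ge0// ltW.
    by rewrite !mulr_ge0 ?powR_ge0// ltW.
  (* For u <= v the ratio is at most A/f, within reach of [karamata_slow]. For v <= u it is at most
     n^(1-gamma) <= n, and Potter's bound with exponent [eta] costs n^eta. *)
  have [uv|/ltW vu] := leP u v.
    have tuv : theta u <= 4 * expR 1 * theta v.
      apply: (slow _ _ u0 uv (vd _ d10 Ld1)); apply: (le_trans lnvu); apply: (le_trans Af).
      rewrite ge0_ler_powR ?nnegrE ?(ltW alpha0)//; first by rewrite divr_ge0// ltW.
      have lnv0 : ln v < 0 by apply: (le_lt_trans lnv); rewrite oppr_lt0 divr_gt0.
      by rewrite ltr0_norm// lerNr.
    apply: (@le_trans _ _ (K * (4 * expR 1) * theta v)).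
      by rewrite -mulrA ler_wpM2l// ltW.
    rewrite ler_wpM2r ?(ltW tv)// (le_trans KA)// ler_peMr// ltW//.
  have [_ tuv] := potter _ _ v0 vu (ud _ d20 Ld2).
  apply: (@le_trans _ _ (K * (4 * n%:R `^ eta * theta v))).
    rewrite ler_wpM2l ?(ltW K_gt0)// (le_trans tuv)// ler_wpM2r ?(ltW tv)// ler_wpM2l//.
    rewrite ge0_ler_powR ?nnegrE ?(ltW eta0) ?(ltW n0') ?(ltW (divr_gt0 u0 v0))//.
    rewrite (le_trans _ Vw)// (_ : u / v = w^-1 * (f / A)); last first.
      by rewrite vE; field; rewrite !gt_eqF.
    rewrite ler_piMr ?invr_ge0 ?(ltW w0)// ler_pdivrMr//; lra.
  by rewrite !mulrA ler_wpM2r ?(ltW tv)// ler_wpM2r// powR_ge0.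
have -> : n%:R * f ^+ 2 * psi v = u `^ kappa * g T * (A `^ kappa * n%:R `^ eta * theta v).
  rewrite psiE// -neta -fg (_ : f `^ (2 - kappa) = f ^+ 2 * (f `^ kappa)^-1); last first.
    by rewrite powRB ?gt_eqF ?implybT// powR_mulrn// ltW.
  rewrite vE powRM ?invr_ge0 ?mulr_ge0 ?ltW// powRM ?mulr_ge0 ?ltW// powRM ?ltW//.
  by rewrite -powR_inv1 ?ltW// -powRrM mulN1r powRN; ring.
rewrite psiE// (_ : K * _ * _ = u `^ kappa * g T * (K * theta u)); last by ring.
rewrite ler_wpM2l ?mulr_ge0 ?powR_ge0// ?(ltW g0)//.
rewrite (le_trans key)// ler_wpM2r ?(ltW tv)// ler_wpM2r ?powR_ge0//.
by rewrite -[leLHS]powRr1 ?ler_powR// ltW.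
Unshelve. all: by end_near. Qed.
End PsiScaling.

(** * Uniform slow variation and dyadic comparison *)

Section UniformSlowVariation.
Variable R : realType.
Local Notation mu := (@lebesgue_measure R).

Lemma lebesgue_measure_shift (u : R) (A : set (measurableTypeR R)) : measurable A ->
  mu ((fun s : R => s - u) @^-1` A) = mu A.
Proof.
pose f (s : measurableTypeR R) : measurableTypeR R := (s : R) - u.
have mf : measurable_fun setT f by apply: measurable_funB.
pose m' : {measure set (measurableTypeR R) -> \bar R} := pushforward mu f.
pose m := m' mf.
move=> mA; apply/esym; apply: (@lebesgue_measure_unique R m) => // X [[a b] _ /= <-].
rewrite /m /m' /pushforward (_ : f @^-1` _ = `](a + u)%R, (b + u)%R]%classic); last first.
  by apply/seteqP; split => x /=; rewrite !in_itv/= /f ltrBrDr lerBlDr.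
rewrite ![LHS]lebesgue_measure_itv ![RHS]lebesgue_measure_itv/= !lte_fin ltrD2r.
by case: ifP => // _; congr (_%:E); ring.
Qed.

Variables (l : R -> R) (x0 : R).
Hypothesis ml : measurable_fun `[x0, +oo[ l.
Hypothesis l_cvg : forall t, 0 <= t -> l (x + t) - l x @[x --> +oo] --> (0 : R).

Let good (y : nat -> R) n := [set t : R | 0 <= t <= 2 /\
  forall m, (n <= m)%N -> `|l (y m + t) - l (y m)| <= 1].

(** Pointwise convergence makes the good sets increase to [0, 2], so their measures tend to 2. The
    threshold 7/4 is chosen because two such sets cannot be disjoint in an interval of length 3. *)
Let good_measure y : (forall n, x0 <= y n) -> (forall n, n%:R <= y n) ->
  exists N, forall n, (N <= n)%N -> measurable (good y n : set (measurableTypeR R)) /\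
    ((7 / 4)%:E <= mu (good y n))%E.
Proof.
move=> yx0 yn.
have mgood n : measurable (good y n : set (measurableTypeR R)).
  rewrite (_ : good y n = \bigcap_(m in [set m | (n <= m)%N])
    (`[0, 2]%classic `&` (fun t => `|l (y m + t) - l (y m)|) @^-1` `]-oo, 1]%classic)); last first.
    apply/seteqP; split => t.
      by move=> [t02 H] m /= nm; split; rewrite /= in_itv//=; exact: H.
    move=> H; split; first by have [] := H n (leqnn n); rewrite /= in_itv.
    by move=> m nm; have [_] := H m nm; rewrite /= in_itv.
  apply: bigcap_measurable => //; first by exists n => /=.
  move=> m _.
  suff mm : measurable_fun (`[0, 2]%classic : set (measurableTypeR R))
      (fun t : measurableTypeR R => `|l (y m + t) - l (y m)|) by exact: mm.
  apply: measurableT_comp => //; apply: measurable_funB => //.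
  apply: (@measurable_comp _ _ _ _ _ _ `[x0, +oo[%classic) => //.
    move=> _ [t /= + <-]; rewrite !in_itv/= andbT => /andP[t0 _].
    by rewrite (le_trans (yx0 m))// lerDl.
  by apply: measurable_funD.
have good_nd : {homo good y : n m / (n <= m)%N >-> (n <= m)%O}.
  move=> n m nm; apply/subsetPset => t [t02 H]; split => // k mk.
  by apply: H; exact: leq_trans mk.
have good_cup : \bigcup_n good y n = `[0, 2]%classic.
  apply/seteqP; split => [t [n _ [t02 _]]|t /=]; rewrite ?in_itv//= => t02.
  have /andP[t0 _] := t02.
  have /cvgrPdist_le/(_ _ ltr01)[M [_ HM]] := l_cvg t0.
  exists (Num.bound M).+1 => //; split => // m Mm.
  have := HM (y m); rewrite sub0r normrN; apply.
  apply: (lt_le_trans _ (yn m)); rewrite (le_lt_trans (ler_norm _))//.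
  have := archi_boundP (normr_ge0 M); rewrite /Num.Def.archi_bound normr_id => H.
  by rewrite (lt_le_trans H)// ler_nat ltnW.
have cvg : mu (good y n) @[n --> \oo] --> mu (\bigcup_n good y n).
  apply: nondecreasing_cvg_mu => //; first by rewrite good_cup; exact: measurable_itv.
have mu2 : mu (\bigcup_n good y n) = 2%:E.
  by rewrite good_cup [LHS]lebesgue_measure_itv/= lte_fin ltr0n/= -EFinB subr0.
move: cvg; rewrite mu2 => /fine_cvgP[_] /cvgrPdist_le/(_ (1/4)).
rewrite divr_gt0// => /(_ erefl)[N _ HN]; exists N => n Nn; split => //.
have := HN n Nn => /=; rewrite ler_norml => /andP[_ H].
have fn : mu (good y n) \is a fin_num.
  rewrite ge0_fin_numE//; apply: (@le_lt_trans _ _ (mu (\bigcup_n good y n))); last by rewrite mu2 ltry.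
  apply: le_measure; rewrite ?inE//; [by apply: bigcup_measurable|exact: bigcup_sup].
by rewrite -(fineK fn) lee_fin; lra.
Qed.

(* If uniformity failed along (x_n, u_n), then for large n the sets where
   [l] is close to [l (x_n)], resp. to [l (x_n + u_n)], would both fill most of
   an interval of length 2 inside [0, 3], hence meet. *)
Lemma slow_variation_uniform : exists X : R, forall x u, X <= x -> 0 <= u <= 1 ->
  `|l (x + u) - l x| <= 2.
Proof.
apply: contrapT => /forallNP H.
have [xu xuP] : {xu : nat -> R * R & forall n, [/\ x0 <= (xu n).1, n%:R <= (xu n).1,
    0 <= (xu n).2 <= 1 & 2 < `|l ((xu n).1 + (xu n).2) - l (xu n).1|]}.
  apply: (@choice _ _ (fun n z => [/\ x0 <= z.1, n%:R <= z.1, 0 <= z.2 <= 1 &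
    2 < `|l (z.1 + z.2) - l z.1|])) => n.
  have := H (Num.max x0 n%:R) => /existsNP[x /existsNP[u]].
  move=> /not_implyP[xX /not_implyP[u01 /negP]]; rewrite -ltNge => lt2.
  by exists (x, u); split => //=; apply: le_trans xX; rewrite le_max lexx ?orbT.
pose x n := (xu n).1; pose u n := (xu n).2; pose z n := x n + u n.
have zx n : x n <= z n by rewrite lerDl; have [_ _ /andP[]] := xuP n.
have [N1 HN1] := @good_measure x (fun n => let: And4 a _ _ _ := xuP n in a)
  (fun n => let: And4 _ a _ _ := xuP n in a).
have [N2 HN2] := @good_measure z
  (fun n => le_trans (let: And4 a _ _ _ := xuP n in a) (zx n))
  (fun n => le_trans (let: And4 _ a _ _ := xuP n in a) (zx n)).
pose N := maxn N1 N2.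
have [mA A74] := HN1 N (leq_maxl _ _); have [mB B74] := HN2 N (leq_maxr _ _).
set A := good x N in mA A74; set B := good z N in mB B74.
have [_ _ /andP[uN0 uN1] uN2] := xuP N; rewrite -/(x N) -/(u N) in uN0 uN1 uN2.
(* Shifting by [u N] expresses both good sets in terms of the same point x N + s. *)
pose B' : set R := (fun s => s - u N) @^-1` B.
have mB' : measurable (B' : set (measurableTypeR R)).
  rewrite -[B']setTI; apply: (_ : measurable_fun setT (fun s : measurableTypeR R => (s : R) - u N)) => //.
  exact: measurable_funB.
have B'74 : ((7 / 4)%:E <= mu B')%E by rewrite lebesgue_measure_shift.
suff : A `&` B' !=set0.
  move=> [s [[_ /(_ N (leqnn N)) sA]]]; rewrite /B'/= => -[_ /(_ N (leqnn N))].
  rewrite /z -addrA (addrC (u N)) subrK => sB.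
  have : `|l (x N + u N) - l (x N)| <= 2.
    rewrite (_ : _ - _ = (l (x N + s) - l (x N)) - (l (x N + s) - l (x N + u N))); last by ring.
    by rewrite (le_trans (ler_normB _ _))//; lra.
  by rewrite leNgt uN2.
apply/set0P/negP => /eqP AB'.
have : (mu (A `|` B') <= mu `[0%R, 3%R]%classic)%E.
  apply: le_measure; rewrite ?inE; [exact: measurableU|exact: measurable_itv|].
  move=> s [[/andP[s0 s2] _]|[/andP[s0 s2] _]] /=; rewrite in_itv/=; lra.
rewrite measureU// [X in (_ <= X)%E]lebesgue_measure_itv/= lte_fin ltr0n/= -EFinB subr0 leNgt.
move=> /negP; apply; apply: (@lt_le_trans _ _ ((7 / 4)%:E + (7 / 4)%:E)%E); last exact: leeD.
by rewrite -EFinD lte_fin; lra.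
Qed.
End UniformSlowVariation.

(** In logarithmic coordinates slow variation is additive. A factor at most 2 is a shift by at most
    ln 2 <= 1, and the uniform bound 2 on the logarithm becomes the factor exp 2. *)
Lemma slowly_varying_local_bound (R : realType) (g : R -> R) :
  slowly_varying_at_infinity g -> exists2 X : R, 0 < X & forall T T', X <= T -> T <= T' <= 2 * T ->
    [/\ 0 < g T, 0 < g T', g T <= expR 2 * g T' & g T' <= expR 2 * g T].
Proof.
move=> [[X0 [mg g_gt0]] g_cvg].
pose X1 := Num.max X0 1; have X10 : 0 < X1 by rewrite lt_max ltr01 orbT.
have X01 : X0 <= X1 by rewrite le_max lexx.
pose l x := ln (g (expR x)).
have ml : measurable_fun (`[ln X1, +oo[%classic : set (measurableTypeR R)) l.
  apply: (measurableT_comp (@measurable_ln R)).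
  apply: (@measurable_comp _ _ _ _ _ _ `[X0, +oo[%classic) => //.
    move=> _ [t /= + <-]; rewrite !in_itv/= !andbT => t1.
    by rewrite (le_trans X01)// -[leLHS]lnK ?posrE// ler_expR.
  by apply: measurable_funTS; exact: measurable_expR.
have l_cvg t : 0 <= t -> l (x + t) - l x @[x --> +oo] --> (0 : R).
  move=> t0; rewrite -(ln1 R).
  have cE : g (expR t * expR x) / g (expR x) @[x --> +oo] --> (1 : R).
    have eoo : expR x @[x --> +oo] --> (+oo : set_system R).
      apply/cvgryPge => M; near=> x; rewrite (le_trans _ (expR_ge1Dx x))// ler_wpDl//.
    exact: (cvg_comp _ _ eoo (g_cvg _ (expR_gt0 t))).
  have : ln (g (expR t * expR x) / g (expR x)) @[x --> +oo] --> ln (1 : R).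
    by apply: continuous_cvg cE; exact: continuous_ln.
  apply: cvg_trans; apply: near_eq_cvg; near=> x.
  have gx y : x <= y -> 0 < g (expR y).
    move=> xy; apply: g_gt0; apply: (le_trans X01).
    rewrite -[leLHS]lnK ?posrE// ler_expR (le_trans _ xy)//.
  have xt : x <= x + t by rewrite lerDl.
  by rewrite -expRD addrC ln_div ?posrE ?gx.
have [X HX] := slow_variation_uniform ml l_cvg.
exists (Num.max X1 (expR X)); first by rewrite lt_max X10.
move=> T T' + /andP[TT' T'2]; rewrite ge_max => /andP[X1T XT].
have T0 : 0 < T by exact: lt_le_trans X1T.
have T'0 : 0 < T' by exact: lt_le_trans TT'.
have gT : 0 < g T by apply: g_gt0; exact: le_trans X1T.
have gT' : 0 < g T' by apply: g_gt0; apply: le_trans TT'; exact: le_trans X1T.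
have u01 : 0 <= ln (T' / T) <= 1.
  rewrite ln_ge0 ?ler_pdivlMr ?mul1r//= -ler_expR lnK ?posrE ?divr_gt0//.
  rewrite ler_pdivrMr// (le_trans T'2)// ler_wpM2r ?(ltW T0)//.
  by have := expR_ge1Dx (1 : R); lra.
have := HX (ln T) (ln (T' / T)).
rewrite -ler_expR lnK ?posrE// XT u01 => /(_ erefl erefl).
have -> : ln T + ln (T' / T) = ln T' by rewrite ln_div ?posrE// addrC subrK.
rewrite /l !lnK ?posrE// ler_norml => /andP[H1 H2].
have e y z : 0 < y -> 0 < z -> ln y <= 2 + ln z -> y <= expR 2 * z.
  by move=> y0 z0 H; rewrite -[y]lnK ?posrE// -[z]lnK ?posrE// -expRD ler_expR.
by split => //; apply: e => //; lra.
Unshelve. all: by end_near. Qed.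

(** Cauchy condensation, with local comparability of g in place of monotonicity. *)
Lemma series_dyadic_lty (R : realType) (g : R -> R) (q : R) : 0 <= q ->
  slowly_varying_at_infinity g ->
  (\forall A \near +oo,
    (\int[lebesgue_measure]_(b in `[A, +oo[) (g b `^ q / b)%:E < +oo)%E) ->
  exists k0, (\sum_(k <oo) (g (2 ^+ (k0 + k)) `^ q)%:E < +oo)%E.
Proof.
move=> q0 g_sv [A0 [_ intA]].
have [X1 X10 gX] := slowly_varying_local_bound g_sv.
have [[X2 [mg _]] _] := g_sv.
pose M : R := 1 + `|A0| + `|X1| + `|X2|.
have [k0 k0M] : exists k0, M <= 2 ^+ k0.
  exists (Num.bound M); apply/ltW/(lt_trans (archi_boundP _)).
    by rewrite !addr_ge0.
  by rewrite -natrX ltr_nat ltn_expl.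
have M1 : 1 <= M by rewrite /M -!addrA lerDl !addr_ge0.
have MA0 : A0 < M by have := ler_norm A0; rewrite /M; have := normr_ge0 X1; have := normr_ge0 X2; lra.
have MX1 : X1 <= M by have := ler_norm X1; rewrite /M; have := normr_ge0 A0; have := normr_ge0 X2; lra.
have MX2 : X2 <= M by have := ler_norm X2; rewrite /M; have := normr_ge0 X1; have := normr_ge0 A0; lra.
clearbody M.
exists k0.
have kM k : (k0 <= k)%N -> M <= 2 ^+ k :> R.
  by move=> kk; rewrite (le_trans k0M)// ler_weXn2l// ler1n.
pose I k : set (measurableTypeR R) := `](2 ^+ (k0 + k) : R), (2 ^+ (k0 + k).+1 : R)]%classic.
pose f (b : measurableTypeR R) : \bar R := (g b `^ q / (b : R))%:E.
have f0 b : (M <= b)%R -> (0 <= f b)%E.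
  by move=> Mb; rewrite lee_fin mulr_ge0 ?powR_ge0// invr_ge0 (le_trans _ Mb)// (le_trans _ M1).
have mf : measurable_fun (`[M, +oo[%classic : set (measurableTypeR R)) f.
  apply/measurable_EFinP; apply: measurable_funM.
    apply: (measurableT_comp (measurable_powR q)).
    by apply: measurable_funS mg => //; apply: subset_itvr; rewrite bnd_simp.
  apply: (@measurable_funS _ _ _ _ (`]0, +oo[%classic : set (measurableTypeR R))) => //.
    by apply: subset_itvr; rewrite bnd_simp (lt_le_trans ltr01).
  apply: open_continuous_measurable_fun; first exact: interval_open.
  by move=> x /[1!inE]/=; rewrite in_itv/= andbT => x0; apply: inv_continuous; rewrite gt_eqF.
have IM k b : I k b -> (M <= b)%R.
  rewrite /I /= in_itv/= => /andP[+ _] => /ltW; apply: le_trans.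
  by apply: kM; exact: leq_addr.
have intI k : ((expR 2 `^ (- q) / 2 * g (2 ^+ (k0 + k)) `^ q)%:E <= \int[lebesgue_measure]_(b in I k) f b)%E.
  have kM' := kM _ (leq_addr k k0); set t : R := 2 ^+ (k0 + k) in kM' *.
  have t0 : 0 < t by rewrite exprn_gt0.
  have IE : I k = `]t, 2 * t]%classic by rewrite /I exprS.
  (* A lower bound for the integrand on ]t, 2t], an interval of length t. *)
  pose c := expR 2 `^ (- q) * g t `^ q / (2 * t).
  have c0 : 0 <= c by rewrite divr_ge0 ?mulr_ge0 ?powR_ge0// ltW.
  have -> : (expR 2 `^ (- q) / 2 * g t `^ q)%:E = (\int[lebesgue_measure]_(b in I k) cst c%:E b)%E.
    rewrite integral_cst; last by rewrite IE; exact: measurable_itv.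
    rewrite IE [X in (_ * X)%E]lebesgue_measure_itv/= lte_fin ltr_pMl// ltr1n -EFinB -EFinM.
    by congr (_%:E); rewrite /c; field; rewrite gt_eqF.
  apply: ge0_le_integral => //.
  - by rewrite IE; exact: measurable_itv.
  - by apply: measurable_funS mf => // b /IM; rewrite /= in_itv/= andbT.
  move=> b; rewrite IE /= in_itv/= => /andP[tb b2t]; rewrite lee_fin /c.
  have b0 : 0 < b by exact: lt_trans tb.
  have [||gt gb gtb _] := gX t b; [exact: le_trans kM'|by rewrite (ltW tb)|].
  apply: ler_pM; rewrite ?mulr_ge0 ?powR_ge0 ?invr_ge0 ?mulr_ge0 ?(ltW t0)//; last first.
    by rewrite lef_pV2 ?posrE// mulr_gt0.
  rewrite powRN mulrC ler_pdivrMr ?powR_gt0 ?expR_gt0// mulrC -powRM ?expR_ge0 ?(ltW gb)//.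
  by rewrite ge0_ler_powR ?nnegrE ?(ltW gt)// mulr_ge0 ?expR_ge0 ?(ltW gb).
have cc0 : 0 < expR 2 `^ (- q) / 2 :> R by rewrite divr_gt0 ?powR_gt0 ?expR_gt0.
have mI k : measurable (I k) by exact: measurable_itv.
have trI : trivIset setT I.
  suff lt_disj i j b : (i < j)%N -> I i b -> I j b -> False.
    move=> i j _ _ [b [bi bj]]; have [ij|ji|//] := ltngtP i j.
      by case: (lt_disj _ _ _ ij bi bj).
    by case: (lt_disj _ _ _ ji bj bi).
  rewrite /I /= !in_itv/= => ij /andP[_ bi] /andP[bj _].
  suff ij' : (2 ^+ (k0 + i).+1 : R) <= 2 ^+ (k0 + j).
    by have := lt_le_trans bj (le_trans bi ij'); rewrite ltxx.
  by rewrite ler_weXn2l ?ler1n// -addnS leq_add2l.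
have fin : (\sum_(k <oo) \int[lebesgue_measure]_(b in I k) f b < +oo)%E.
  have UM : \bigcup_k I k `<=` `[M, +oo[%classic.
    by move=> b [k _ /IM]; rewrite /= in_itv/= andbT.
  have fM b : `[M, +oo[%classic b -> (0 <= f b)%E by rewrite /= in_itv/= andbT => /f0.
  have mU : measurable_fun (\bigcup_k I k) f.
    by apply: measurable_funS mf => //; exact: measurable_itv.
  have fU b : (\bigcup_k I k) b -> (0 <= f b)%E by move=> /UM/fM.
  rewrite -ge0_integral_bigcup//; apply: le_lt_trans (intA _ MA0).
  by apply: ge0_subset_integral => //; exact: bigcup_measurable.
have : ((expR 2 `^ (- q) / 2)%:E * \sum_(k <oo) (g (2 ^+ (k0 + k)) `^ q)%:E < +oo)%E.
  rewrite -nneseriesZl; last by move=> k _; rewrite lee_fin powR_ge0.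
  by apply: le_lt_trans fin; apply: lee_nneseries => // k _; rewrite -?EFinM// lee_fin mulr_ge0 ?powR_ge0// ltW.
by rewrite !ltey; apply: contra_neq => ->; rewrite gt0_muley// lte_fin.
Qed.

(** * The Wiener process *)

(** [normal_prob] is a measure on [measurableTypeR R], whereas [nu] uses the structure carried by
    [R]; the identity [j] transports one to the other. *)
Lemma integral_eq_normal (R : realType) (nu : {measure set R -> \bar R}) (sigma u : R) :
  (forall A, measurable A -> nu A = normal_prob 0 sigma A) ->
  (\int[nu]_x (Num.max (u - x) 0)%:E =
   \int[normal_prob 0 sigma]_x (Num.max (u - x) 0)%:E)%E.
Proof.
move=> nuE.
pose j (x : measurableTypeR R) : R := x.
have mj : measurable_fun setT j by move=> _ A mA; rewrite setTI.
pose N' : {measure set R -> \bar R} := pushforward (normal_prob 0 sigma) j.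
pose N1 := N' mj.
rewrite (@eq_measure_integral _ _ _ setT N1); last first.
  by move=> A mA _; exact: nuE.
rewrite ge0_integral_pushforward//.
- apply/measurable_EFinP; apply: measurable_maxr => //; exact: measurable_funB.
- by move=> x _; rewrite lee_fin le_max lexx orbT.
Qed.

Section WienerBarrier.
Variables (d : measure_display) (Omega : measurableType d) (R : realType).
Variables (P : probability Omega R) (W : R -> {RV P >-> R}).
Hypothesis hW : wiener_process W.

Lemma measurable_grid_barrier (h : R) (b : nat -> R) n :
  measurable [set w | forall i, (i <= n)%N -> W (i%:R * h) w - W 0 w <= b i].
Proof.
rewrite (_ : [set w | _] = \bigcap_(i in [set i | (i <= n)%N])
    [set w | W (i%:R * h) w - W 0 w <= b i]); last by apply/seteqP; split.
apply: bigcap_measurable; first by exists 0%N.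
by move=> i _; apply: measurable_le_preimage; exact: measurable_funB.
Qed.

(** [W 0] is subtracted because it vanishes only almost surely, while the walk of increments starts
    exactly at 0. [M] serves all [h], by the scaling in [walk_survival_le]. *)
Lemma wiener_grid_barrier gamma B : 0 < gamma < 1 / 2 -> 0 <= B ->
  exists M : R, forall (h : R) n, 0 < h -> (0 < n)%N ->
    (P [set w | forall i, (i <= n)%N ->
       (W (i%:R * h) w - W 0 w <= Num.sqrt h * (B * i%:R `^ gamma))%R] <=
     (M / Num.sqrt n%:R)%:E)%E.
Proof.
move=> g12 B0.
have p00 : 0 < expR (-2) / Num.sqrt (pi *+ 2) :> R.
  by rewrite divr_gt0 ?expR_gt0// sqrtr_gt0 pmulrn_lgt0// pi_gt0.
have [M HM] := walk_survival_le g12 B0 (ler0n R 3) p00.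
exists M => h n h0 n0.
have s0 : 0 < Num.sqrt h by rewrite sqrtr_gt0.
pose X (i : nat) (w : Omega) := W (i.+1%:R * h) w - W (i%:R * h) w.
have mX i : measurable_fun setT (X i) by exact: measurable_funB.
have XN i (A : set R) : measurable A -> P (X i @^-1` A) = normal_prob 0 (Num.sqrt h) A.
  move=> mA; have := wiener_normal hW (s := i%:R * h) (t := i.+1%:R * h).
  rewrite (_ : i.+1%:R * h - i%:R * h = h); last by rewrite -natr1; ring.
  apply => //; first by rewrite mulr_ge0// ltW.
  by rewrite ltr_pM2r// ltr_nat.
have psE k w : partial_sum X k w = W (k%:R * h) w - W 0 w.
  rewrite /partial_sum; elim: k => [|k ih]; first by rewrite big_ord0 mul0r subrr.
  by rewrite big_ord_recr/= ih /X; ring.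
have -> : [set w | forall i, (i <= n)%N ->
      W (i%:R * h) w - W 0 w <= Num.sqrt h * (B * i%:R `^ gamma)] =
    [set w | forall i, (i <= n)%N -> partial_sum X i w <= Num.sqrt h * (B * i%:R `^ gamma)].
  by apply/seteqP; split => w /= H i /H; rewrite psE.
apply: (HM _ _ P X mX) => //.
- move=> k A mA; have := wiener_indep hW (n := k) (t := fun i => i%:R * h) (A := A).
  apply => //; first by rewrite mul0r.
  by move=> i _; rewrite ler_wpM2r ?ler_nat// ltW.
- move=> k u u0; rewrite (XN k); last exact: measurable_itv.
  rewrite (integral_eq_normal (sigma := Num.sqrt h))//.
  - exact: normal_positive_part.
  - by move=> A mA; rewrite -(XN k).
- move=> k k0.
  have k0' : (0 : R) < k%:R by rewrite ltr0n.
  rewrite (_ : [set w | _] = (W (k%:R * h) \- W 0) @^-1` `]-oo, - Num.sqrt (k%:R * h)]%classic); last first.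
    by apply/seteqP; split => w /=; rewrite in_itv/= psE sqrtrM ?(ltW k0')// (mulrC (Num.sqrt k%:R)).
  rewrite (wiener_normal hW)//; last by rewrite mulr_gt0.
  by rewrite subr0; apply: normal_lower_tail; rewrite sqrtr_gt0 mulr_gt0.
Qed.
End WienerBarrier.

Lemma min_energy_ge (R : realType) (psi w : R -> R) (T r s e : R) :
  (forall u, 0 <= psi u) -> @convex_function R R^o setT psi ->
  (forall x y, 0 <= x -> x <= y -> psi x <= psi y) ->
  0 < s <= T -> 0 <= e -> r + e <= w s ->
  ((s * psi (e / s))%:E <= min_energy psi w T r)%E.
Proof.
move=> psi_ge0 cpsi psi_nd sT e0 rew; have /andP[s0 sT'] := sT.
apply: le_ereal_inf_tmp => _ [h [ach h0 wh] <-].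
apply: le_trans (energy_ge psi_ge0 cpsi sT ach); rewrite lee_fin ler_wpM2l ?(ltW s0)//.
apply: psi_nd; first by rewrite divr_ge0// ltW.
rewrite ler_wpM2r ?invr_ge0 ?(ltW s0)// h0.
by have := wh s; rewrite (ltW s0) sT' => /(_ erefl); lra.
Qed.

(** * Consequences of the logarithmic bounds on g *)

Section GrowthOfG.
Variables (R : realType) (g : R -> R) (xi1 xi2 : R).
Hypothesis xi2_gt0 : 0 < xi2.
Hypothesis g_lower : (fun b : R => ln b `^ (- xi1)) =O_ (pinfty_nbhs R) g.
Hypothesis g_upper : g =O_ (pinfty_nbhs R) (fun b : R => ln b `^ (- xi2)).
Hypothesis g_gt0 : \forall T \near +oo, 0 < g T.

Lemma g_ge_powR_ln : exists2 C : R, 0 < C & \forall T \near +oo, C * ln T `^ (- xi1) <= g T.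
Proof.
have /eqO_exP[k k0 H] := g_lower; exists k^-1; first by rewrite invr_gt0.
near=> T; rewrite ler_pdivrMl//.
have : `|ln T `^ (- xi1)| <= k * `|g T| by near: T.
rewrite (ger0_norm (powR_ge0 _ _)) gtr0_norm//.
by near: T.
Unshelve. all: by end_near. Qed.

(** Yields f <= 1, so that the sampling step h does not exceed T. *)
Lemma g_le_1 : \forall T \near +oo, g T <= 1.
Proof.
have /eqO_exP[k k0 H] := g_upper.
have Lk := near_pinfty_ln (near_pinfty_ge (k `^ xi2^-1)).
near=> T.
have gT : `|g T| <= k * `|ln T `^ (- xi2)| by near: T.
have lnT : k `^ xi2^-1 <= ln T by near: T.
apply: (le_trans (ler_norm _)); apply: (le_trans gT).
rewrite ger0_norm ?powR_ge0// powRN ler_pdivrMr; last first.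
  by rewrite powR_gt0// (lt_le_trans _ lnT)// powR_gt0.
rewrite mul1r; have := ge0_ler_powR (ltW xi2_gt0) _ _ lnT.
rewrite -powRrM mulVf ?gt_eqF// (powRr1 (ltW k0)) !nnegrE powR_ge0 => /(_ erefl); apply.
by rewrite (le_trans (powR_ge0 _ _) lnT).
Unshelve. all: by end_near. Qed.

(** For the exponent p = 1/(2-kappa) the right side is sqrt h, so the starting height r costs at
    most one unit of barrier. In logarithms, ln T / 2 beats the two losses of at most ln T / 4. *)
Lemma sqrt_mul_g_large (p r : R) : 0 < p -> \forall T \near +oo, r <= Num.sqrt T * g T `^ p.
Proof.
move=> p0; have [C C0 gC] := g_ge_powR_ln.
have main := near_pinfty_ln (affine_ln_le_powR (- p * ln C) (p * xi1) ltr01).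
have Lr := near_pinfty_ln (near_pinfty_ge (4 * ln (`|r| + 1))).
have L1 := near_pinfty_ln (near_pinfty_ge (1 : R)).
near=> T.
have {}gT : C * ln T `^ (- xi1) <= g T by near: T.
have g0 : 0 < g T by near: T.
have T0 : 0 < T by near: T; exact: nbhs_pinfty_gt.
have H1 : - p * ln C + p * xi1 * ln (ln T) <= (ln T / 4) `^ 1 by near: T.
have H2 : 4 * ln (`|r| + 1) <= ln T by near: T.
have H3 : 1 <= ln T by near: T.
move: gT H1 H2 H3; have := erefl (ln T); move: {2 3 4 5 6 7}(ln T) => L LE gT H1 H2 H3.
have L0 : 0 < L by lra.
have r1 : 0 < `|r| + 1 by rewrite ltr_wpDl.
apply: (@le_trans _ _ (`|r| + 1)); first by rewrite (le_trans (ler_norm _))// lerDl.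
rewrite -ler_ln ?posrE ?mulr_gt0 ?sqrtr_gt0 ?powR_gt0//.
rewrite lnM ?posrE ?sqrtr_gt0 ?powR_gt0// ln_powR -(powR12_sqrt (ltW T0)) ln_powR LE.
have : ln C - xi1 * ln L <= ln (g T).
  apply: (@le_trans _ _ (ln (C * L `^ (- xi1)))); last first.
    by rewrite ler_ln ?posrE ?mulr_gt0 ?powR_gt0.
  by rewrite lnM ?posrE ?powR_gt0// ln_powR mulNr.
move=> /(ler_wpM2l (ltW p0)); rewrite mulrBr mulrA => H.
move: H1; rewrite powRr1 ?divr_ge0 ?(ltW L0)// mulNr => {}H1; lra.
Unshelve. all: by end_near. Qed.
End GrowthOfG.

(** * Dyadic times and the almost sure bound *)

Lemma eventually_exp2 (R : realType) (Q : R -> Prop) :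
  (\forall T \near +oo, Q T) -> exists k0, forall k, (k0 <= k)%N -> Q (2 ^+ k).
Proof.
move=> [M [_ MQ]]; exists (Num.bound M) => k Mk; apply: MQ.
have := archi_boundP (normr_ge0 M); rewrite /Num.Def.archi_bound normr_id => H.
rewrite (le_lt_trans (ler_norm _))// (lt_le_trans H)// -natrX ler_nat.
exact: leq_trans Mk (ltnW (ltn_expl _ _)).
Qed.

Lemma dyadic_bracket (R : realType) (k0 : nat) (T : R) : 2 ^+ k0 <= T ->
  exists2 k, (k0 <= k)%N & 2 ^+ k <= T <= 2 * 2 ^+ k.
Proof.
move=> kT.
have ex : exists k, T <= 2 ^+ k.+1.
  exists (Num.bound T); have := archi_boundP (normr_ge0 T).
  rewrite /Num.Def.archi_bound normr_id => H.
  rewrite (le_trans (ler_norm _))// (le_trans (ltW H))// -natrX ler_nat.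
  exact: leq_trans (ltnW (ltn_expl _ _)) (leq_pexp2l _ (leqnSn _)).
have [m mT mmin] := ex_minnP ex.
have [k0m|mk0] := leqP k0 m; last first.
  by exists k0 => //; rewrite kT/= -exprS (le_trans mT)// ler_weXn2l ?ler1n// ltnS ltnW.
exists m => //; rewrite -exprS mT andbT.
case: m mT mmin k0m => [|m] mT mmin k0m.
  by apply: le_trans kT; rewrite ler_weXn2l// ler1n.
by rewrite leNgt; apply/negP => Tm; have := mmin m (ltW Tm); rewrite ltnn.
Qed.

(** n is the integer part of f^(-2) >= 1. Truncating a number at least 1 loses at most a factor 2,
    so f^(-2) <= 4 n. *)
Lemma scaled_floor (R : realType) (f : R) : 0 < f <= 1 ->
  exists n : nat, [/\ (0 < n)%N, n%:R * f ^+ 2 <= 1 & (Num.sqrt n%:R)^-1 <= 2 * f].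
Proof.
move=> /andP[f0 f1]; pose y := f ^- 2; pose n := Num.truncn y.
have f20 : 0 < f ^+ 2 by rewrite exprn_gt0.
have y1 : 1 <= y by rewrite invf_ge1// expr_le1// ltW.
have y0 : 0 <= y by exact: le_trans y1.
have /andP[ny yn] := truncn_itv y0.
have n0 : (0 < n)%N.
  by rewrite lt0n; apply/eqP => n0; move: yn; rewrite -/n n0 ltNge y1.
exists n; split => //.
  by rewrite -ler_pdivlMr// div1r.
have n0' : (0 : R) < n%:R by rewrite ltr0n.
have yn2 : y <= 4 * n%:R.
  have : n.+1%:R <= 4 * n%:R :> R 
    by rewrite -natrM ler_nat -addn1 (leq_trans (leq_add (leqnn n) n0))// addnn -mul2n leq_mul2r orbT.
  by move=> H; rewrite (le_trans (ltW yn)).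
have s0 : 0 < Num.sqrt n%:R :> R by rewrite sqrtr_gt0.
rewrite -[leLHS]mul1r ler_pdivrMr// -ler_sqr ?nnegrE ?ler01 ?mulr_ge0 ?sqrtr_ge0 ?(ltW f0)//.
rewrite expr1n !exprMn sqr_sqrtr ?ler0n//.
by move: yn2; rewrite /y -[f ^- 2]mul1r ler_pdivrMr//; lra.
Qed.

Theorem theorem1 (d : measure_display) (Omega : measurableType d)
    (R : realType) (P : probability Omega R) (W : R -> {RV P >-> R})
    (hW : wiener_process W)
    (psi : R -> R) (psi_ge0 : forall u : R, 0 <= psi u)
    (psi_convex : @convex_function R R^o setT psi)
    (kappa : R) (hkappa : 1 <= kappa < 2)
    (theta : R -> R) (psiE : forall u : R, 0 < u -> psi u = u `^ kappa * theta u)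
    (theta_sv : slowly_varying_at_zero theta)
    (c eps : R -> R) (theta_karamata : karamata_representation theta c eps)
    (eps_small : exists alpha : R, 0 < alpha < 1 /\
       \forall v \near (0:R)^'+, eps v < 1 / `|ln v| `^ alpha)
    (g : R -> R) (g_sv : slowly_varying_at_infinity g)
    (g_log : exists xi1 xi2 : R, [/\ 2 - kappa < xi1, xi2 < 2 - kappa, 0 < xi2,
       (fun b : R => ln b `^ (- xi1)) =O_ (pinfty_nbhs R) g &
       g =O_ (pinfty_nbhs R) (fun b : R => ln b `^ (- xi2))])
    (g_int : \forall A \near +oo,
       (\int[lebesgue_measure]_(b in `[A, +oo[)
          (g b `^ (2 - kappa)^-1 / b)%:E < +oo)%E)
    (r : R) (hr : 0 < r) :
  {ae P, forall w : Omega,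
    limf_einf (fun T : R => (min_energy psi (W ^~ w) T r *
        ((T * psi ((Num.sqrt T)^-1) * g T)^-1)%:E)%E) (pinfty_nbhs R) = +oo%E}.
Proof.
have /andP[kappa1 kappa2] := hkappa.
have psi_cvx x y t : 0 <= t <= 1 -> psi (t * x + (1 - t) * y) <= t * psi x + (1 - t) * psi y.
  exact: convex_functionE.
have psi_nd x y := psi_nondecreasing psi_ge0 psi_cvx kappa1 psiE theta_karamata (x := x) (y := y).
have [xi1 [xi2 [_ _ xi20 g_lower g_upper]]] := g_log.
have [X1 X10 gX] := slowly_varying_local_bound g_sv.
have g_gt0 T : X1 <= T -> 0 < g T.
  move=> XT; have TT : T <= T <= 2 * T.
    by rewrite lexx ler_peMl ?ler1n// ltW// (lt_le_trans X10).
  by case: (gX T T XT TT).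
have g_gt0' : \forall T \near +oo, 0 < g T by apply: filterS (near_pinfty_ge X1).
pose p := (2 - kappa)^-1; have p0 : 0 < p by rewrite invr_gt0 subr_gt0.
pose phi T := T * psi ((Num.sqrt T)^-1) * g T.
(* The midpoint of the interval from 1 - 1/kappa to 1/2. *)
pose gamma := ((1 - kappa^-1) + 1 / 2) / 2.
have k0 : 0 < kappa by exact: lt_le_trans kappa1.
have kV : kappa^-1 <= 1 by rewrite invf_le1.
have kV2 : 1 / 2 < kappa^-1 by rewrite div1r ltf_pV2 ?posrE.
have gamma12 : 0 < gamma < 1 / 2 by rewrite /gamma; apply/andP; split; lra.
have gamma01 : 0 <= gamma <= 1 by rewrite /gamma; apply/andP; split; lra.
have gammak : 0 < 1 - kappa * (1 - gamma).
  rewrite subr_gt0 mulrC -ltr_pdivlMr// div1r /gamma; lra.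
(* The exceptional null set depends on [K], so the multiples are restricted to natural numbers when
   the almost sure events are intersected. *)
suff main (K : R) : 0 <= K -> {ae P, forall w, \forall T \near +oo,
    ((K * phi T)%:E <= min_energy psi (W ^~ w) T r)%E}.
  have : {ae P, forall w, forall n : nat, \forall T \near +oo,
      ((n%:R * phi T)%:E <= min_energy psi (W ^~ w) T r)%E}.
    by apply/ae_foralln => n; exact: main.
  apply: filterS => w Hw; apply/eqyP => A A0.
  rewrite limf_einfE.
  have phi0 : \forall T \near +oo, 0 < phi T.
    near=> T.
    have T1 : 1 < T by near: T; exact: nbhs_pinfty_gt.
    have T0 : 0 < T by exact: lt_trans T1.
    rewrite /phi !mulr_gt0//; last by near: T.
    apply: (psi_gt0_near0 psiE theta_karamata).
    rewrite invr_gt0 sqrtr_gt0 T0/= invf_lt1 ?sqrtr_gt0//.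
    by rewrite -sqrtr1 ltr_sqrt.
  pose n := Num.bound A.
  have [M [Mr HM]] : \forall T \near +oo,
      (A%:E <= min_energy psi (W ^~ w) T r * ((phi T)^-1)%:E)%E.
    have Hn := Hw n; near=> T.
    have ph : 0 < phi T by near: T.
    rewrite -[X in (_ <= _ * X)%E]/(_%:E) lee_pdivlMr//.
    apply: (@le_trans _ _ (n%:R * phi T)%:E); last by near: T.
    rewrite -EFinM lee_fin ler_wpM2r ?(ltW ph)//.
    by have /ltW := archi_boundP (ltW A0).
  apply: (@le_trans _ _ (ereal_inf ((fun T : R => (min_energy psi (W ^~ w) T r *
     ((T * psi ((Num.sqrt T)^-1) * g T)^-1)%:E)%E) @` `]M, +oo[%classic))).
    apply: le_ereal_inf_tmp => _ [T /= + <-]; rewrite in_itv/= andbT.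
    exact: HM.
  apply: ereal_sup_ubound; exists `]M, +oo[%classic => //.
  by exists M; split => // x Mx /=; rewrite in_itv/= Mx.
move=> K0.
have [C C0 gC] := g_ge_powR_ln g_lower g_gt0'.
have gle1 := g_le_1 xi20 g_upper.
(* Passing from 2^k to T <= 2 * 2^k costs 2 for the factor T and exp 2 for g. *)
pose K' := 2 * expR 2 * K.
have [A A1 Hscal] := psi_scaling hkappa psiE theta_karamata eps_small C0 gC gle1 gamma01 gammak K'.
have Hr := sqrt_mul_g_large g_lower g_gt0' r p0.
have A10 : 0 <= A + 1 by rewrite addr_ge0// (le_trans ler01).
(* The barrier has coefficient A + 1: A for the energy bound, 1 to absorb r. *)
have [M HM] := wiener_grid_barrier hW gamma12 A10.
have [ks sumg] := series_dyadic_lty (ltW p0) g_sv g_int.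
have [k1 Hk1] : exists k1, forall k, (k1 <= k)%N -> [/\ X1 <= 2 ^+ k, g (2 ^+ k) <= 1,
    r <= Num.sqrt (2 ^+ k) * g (2 ^+ k) `^ p &
    forall n : nat, (0 < n)%N -> forall f u : R,
    f = g (2 ^+ k) `^ (2 - kappa)^-1 -> u = (Num.sqrt (2 ^+ k))^-1 ->
    K' * psi u * g (2 ^+ k) <= n%:R * f ^+ 2 * psi (A * n%:R `^ (gamma - 1) * u / f)].
  apply: (eventually_exp2 (Q := fun T => [/\ X1 <= T, g T <= 1,
    r <= Num.sqrt T * g T `^ p & forall n : nat, (0 < n)%N -> forall f u : R,
    f = g T `^ (2 - kappa)^-1 -> u = (Num.sqrt T)^-1 ->
    K' * psi u * g T <= n%:R * f ^+ 2 * psi (A * n%:R `^ (gamma - 1) * u / f)])).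
  near=> T; split; near: T; [exact: near_pinfty_ge|exact: gle1|exact: Hr|exact: Hscal].
pose f k := g (2 ^+ k) `^ p.
have f01 k : (k1 <= k)%N -> 0 < f k <= 1.
  move=> /Hk1[Xk g1 _ _]; have gk := g_gt0 _ Xk.
  rewrite powR_gt0//= /f -[leRHS](powRr0 (g (2 ^+ k))) /powR gt_eqF// ler_expR mul0r.
  by apply: mulr_ge0_le0; [exact: (ltW p0)|exact: ln_le0].
have [N HN] : {N : nat -> nat & forall k, (k1 <= k)%N -> [/\ (0 < N k)%N,
    (N k)%:R * f k ^+ 2 <= 1 & (Num.sqrt (N k)%:R)^-1 <= 2 * f k]}.
  apply: (@choice _ _ (fun k n => (k1 <= k)%N -> [/\ (0 < n)%N,
    n%:R * f k ^+ 2 <= 1 & (Num.sqrt n%:R)^-1 <= 2 * f k])) => k.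
  have [/f01/scaled_floor[n Hn]|] := leqP k1 k; first by exists n.
  by exists 0%N.
pose h k := 2 ^+ k * f k ^+ 2.
have h0 k : (k1 <= k)%N -> 0 < h k.
  by move=> /f01/andP[fk0 _]; rewrite mulr_gt0// exprn_gt0.
have sqrth k : (k1 <= k)%N -> Num.sqrt (h k) = Num.sqrt (2 ^+ k) * f k.
  by move=> /f01/andP[fk0 _]; rewrite sqrtrM ?exprn_ge0// sqrtr_sqr gtr0_norm.
pose E k := [set w | forall i, (i <= N k)%N ->
  W (i%:R * h k) w - W 0 w <= Num.sqrt (h k) * ((A + 1) * i%:R `^ gamma)].
(* The index starts at [ks], where the dyadic series is controlled; below [k1], where the estimates
   may fail, the event is replaced by the empty set. *)
pose F j := if (k1 <= ks + j)%N then E (ks + j)%N else set0.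
have mF j : measurable (F j).
  by rewrite /F; case: ifP => // _; exact: measurable_grid_barrier.
have sumF : (\sum_(j <oo) P (F j) < +oo)%E.
  apply: (@le_lt_trans _ _ (\sum_(j <oo) (`|M| * 2)%:E * (g (2 ^+ (ks + j)) `^ p)%:E)%E).
    apply: lee_nneseries => // j _; rewrite /F; case: ifP => [kj|_]; last first.
      by rewrite measure0 -EFinM lee_fin !mulr_ge0 ?powR_ge0.
    have [Nj _ Nf] := HN _ kj.
    apply: le_trans (HM _ _ (h0 _ kj) Nj) _.
    rewrite -EFinM lee_fin (le_trans (ler_norm _))// normrM -mulrA ler_wpM2l//.
    by rewrite ger0_norm// invr_ge0 sqrtr_ge0.
  rewrite nneseriesZl; last by move=> j _; rewrite lee_fin powR_ge0.
  by rewrite lte_mul_pinfty// lee_fin mulr_ge0.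
have negF : P.-negligible (lim_sup_set F).
  apply/negligibleP; last exact: lim_sup_set_cvg0.
  by apply: bigcap_measurable => // n _; exact: bigcup_measurable.
have W0 := wiener_0 hW.
have notF : {ae P, forall w, ~ lim_sup_set F w}.
  by apply: negligibleS negF => w /= /contrapT.
apply: filterS2 W0 notF => w w0 nFw.
have [j0 Hj0] : exists j0, forall j, (j0 <= j)%N -> ~ F j w.
  apply: contrapT => /forallNP H; apply: nFw => n _.
  by have /existsNP[j /not_implyP[nj /contrapT Fj]] := H n; exists j.
pose k2 := (ks + j0 + k1)%N.
exists (2 ^+ k2); split; first exact: num_real.
move=> T /ltW/dyadic_bracket[k k2k /andP[kT Tk]].
have kk1 : (k1 <= k)%N by apply: leq_trans k2k; exact: leq_addl.
have [Xk gk1 rk Hscalk] := Hk1 _ kk1.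
have nE : ~ E k w.
  have -> : E k = F (k - ks)%N by rewrite /F subnKC ?kk1// (leq_trans _ k2k)// /k2 -addnA leq_addr.
  apply: Hj0; rewrite leq_subRL.
    by rewrite (leq_trans _ k2k)// /k2 leq_addr.
  by rewrite (leq_trans _ k2k)// /k2 -addnA leq_addr.
have /existsNP[i /not_implyP[iN /negP]] := nE; rewrite -ltNge => iW.
(* At i = 0 the increment is 0 and the barrier nonnegative, so the barrier cannot be exceeded
   there. *)
have i0 : (0 < i)%N.
  rewrite lt0n; apply/eqP => i0; move: iW; rewrite i0 mul0r subrr ltNge.
  by rewrite !mulr_ge0 ?powR_ge0 ?sqrtr_ge0.
have i0' : (0 : R) < i%:R by rewrite ltr0n.
have i1' : (1 : R) <= i%:R by rewrite ler1n.
have [Nk Nfk _] := HN _ kk1; have /andP[fk0 fk1] := f01 _ kk1.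
have t0 : (0 : R) < 2 ^+ k by rewrite exprn_gt0.
have s0 : 0 < i%:R * h k by rewrite mulr_gt0// h0.
have sT : i%:R * h k <= T.
  apply: le_trans kT; rewrite /h mulrCA ler_piMr ?(ltW t0)//.
  by rewrite (le_trans _ Nfk)// ler_wpM2r ?ler_nat// exprn_ge0// ltW.
have ig : 1 <= i%:R `^ gamma :> R.
  by rewrite -[leLHS](powRr0 i%:R) ler_powR//; have /andP[/ltW] := gamma12.
pose e := Num.sqrt (h k) * (A * i%:R `^ gamma).
have e0 : 0 <= e by rewrite !mulr_ge0 ?sqrtr_ge0 ?powR_ge0// (le_trans ler01).
have rew : r + e <= W (i%:R * h k) w.
  (* Uses r <= sqrt h and i^gamma >= 1. *)
  have rs : r <= Num.sqrt (h k) * i%:R `^ gamma.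
    by rewrite sqrth// (le_trans rk)// ler_peMr// mulr_ge0 ?sqrtr_ge0 ?powR_ge0.
  move: iW; rewrite w0 subr0 => /ltW; apply: le_trans.
  by rewrite /e mulrDl mul1r mulrDr addrC lerD2l.
have sT' : 0 < i%:R * h k <= T by rewrite s0.
apply: le_trans (@min_energy_ge R psi (W ^~ w) T r _ e psi_ge0 psi_convex psi_nd sT' e0 rew).
rewrite lee_fin.
have := Hscalk i i0 _ _ erefl erefl.
have -> : A * i%:R `^ (gamma - 1) * (Num.sqrt (2 ^+ k))^-1 / g (2 ^+ k) `^ (2 - kappa)^-1 =
    e / (i%:R * h k).
  rewrite -/p -/(f k) /e sqrth// /h powRB ?(gt_eqF i0') ?implybT// (powRr1 (ltW i0')).
  rewrite -[X in _ = _ / (_ * (X * _))](sqr_sqrtr (ltW t0)); field.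
  by rewrite !gt_eqF ?sqrtr_gt0.
rewrite -/p -/(f k); set Psi := psi (e / _) => H.
(* It remains to compare phi T with its value at 2^k: psi(1/sqrt T) decreases in T, while T and g(T)
   grow by at most 2 and exp 2. *)
apply: (@le_trans _ _ (2 ^+ k * (K' * psi (Num.sqrt (2 ^+ k))^-1 * g (2 ^+ k)))); last first.
  rewrite (_ : i%:R * h k * Psi = 2 ^+ k * (i%:R * f k ^+ 2 * Psi)); last by rewrite /h; ring.
  by rewrite ler_wpM2l// ltW.
have T0 : 0 < T by exact: lt_le_trans kT.
have [gk gT _ gTk] : [/\ 0 < g (2 ^+ k), 0 < g T, g (2 ^+ k) <= expR 2 * g T & g T <= expR 2 * g (2 ^+ k)].
  by apply: gX => //; rewrite kT.
have psiT : psi (Num.sqrt T)^-1 <= psi (Num.sqrt (2 ^+ k))^-1.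
  apply: psi_nd; first by rewrite invr_ge0 sqrtr_ge0.
  by rewrite lef_pV2 ?posrE ?sqrtr_gt0// ler_wsqrtr.
rewrite (_ : 2 ^+ k * _ = K * ((2 * 2 ^+ k) * psi (Num.sqrt (2 ^+ k))^-1 * (expR 2 * g (2 ^+ k)))); last first.
  by rewrite /K'; ring.
rewrite ler_wpM2l// /phi ler_pM ?(ltW gT) ?mulr_ge0 ?(ltW T0)//.
by rewrite ler_pM ?(ltW T0).
Unshelve. all: by end_near. Qed.
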